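(* Let $K$ be a field of characteristic $p>0$ and let $a\in K^{{\mathbb N}}$ be a $K$-recurrence sequence of order $d$. Then ${\mathcal Z}(a)=\{n\in{\mathbb N}\mid a(n)=0\}$ is $p$-normal of order $\le d-2$, i.e. there are a $p$-nested set $B$ of order $\le d-2$ and finitely many infinite arithmetic progressions $A_1,\dots,A_s$ such that ${\mathcal Z}(a)$ and $B\cup A_1\cup\dots\cup A_s$ have finite symmetric difference.
   Context: ${\mathbb N}=\{0,1,2,\dots\}$. A sequence $a\in K^{{\mathbb N}}$ is a $K$-recurrence sequence of order $d$ if $d$ is the smallest integer $\ge0$ for which there exist $\gamma_0,\dots,\gamma_{d-1}\in K$ with $a(n+d)=\gamma_{d-1}a(n+d-1)+\cdots+\gamma_0a(n)$ for all $n\in{\mathbb N}$. An infinite arithmetic progression is a set $m+n{\mathbb N}$, $m\in{\mathbb N}$, $n\ge1$. Let $q$ be a power of $p$. For $r\ge1$ and $c_0,\dots,c_r\in{\mathbb Q}$ with $(q-1)c_i\in{\mathbb Z}$ for all $i$, $c_0+\cdots+c_r\in{\mathbb Z}$ and $c_i\neq0$ for $1\le i\le r$, put $S_q(c_0;c_1,\dots,c_r)=\{c_0+c_1q^{k_1}+\cdots+c_rq^{k_r}\mid k_1,\dots,k_r\in{\mathbb N}\}\cap{\mathbb N}$. If moreover $c_i>0$ for some $1\le i\le r$, this set is called an elementary $p$-nested set of order $r$. A $p$-nested set of order $\le k$ is the union of a finite set and finitely many elementary $p$-nested sets (for possibly different powers $q$ of $p$) of orders $\le k$; in particular for $k\le0$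 it is just a finite set. *)

(* Defs.v *)
From mathcomp Require Import all_boot all_order all_algebra.
Set Implicit Arguments. Unset Strict Implicit. Unset Printing Implicit Defensive.
Import Order.TTheory GRing.Theory Num.Theory.
Local Open Scope ring_scope.

Definition satisfies_rec (K : fieldType) (a : nat -> K) (d : nat) : Prop :=
  exists g : 'I_d -> K,
    forall n : nat, a (n + d)%N = \sum_(i < d) g i * a (n + i)%N.

Definition rec_order (K : fieldType) (a : nat -> K) (d : nat) : Prop :=
  satisfies_rec a d /\ (forall e : nat, satisfies_rec a e -> (d <= e)%N).

Definition is_int (x : rat) : Prop := exists z : int, x = z%:~R.

Definition S_q (q : nat) (r : nat) (c0 : rat) (c : 'I_r -> rat) (n : nat) : Prop :=
  exists k : 'I_r -> nat, c0 + \sum_(i < r) c i * (q ^ k i)%N%:R = n%:R.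

Definition elementary_pnested (p : nat) (r : nat) (S : nat -> Prop) : Prop :=
  (1 <= r)%N /\
  exists (e : nat) (c0 : rat) (c : 'I_r -> rat),
    let q := (p ^ e)%N in
    (1 <= e)%N /\
    is_int ((q.-1)%:R * c0) /\ (forall i, is_int ((q.-1)%:R * c i)) /\
    is_int (c0 + \sum_(i < r) c i) /\
    (forall i, c i != 0) /\ (exists i, 0 < c i) /\
    (forall n, S n <-> S_q q c0 c n).

(* B is a p-nested set of order <= k (k a natural number; order <= k with
   k <= 0 means B is finite) *)
Definition pnested (p : nat) (k : nat) (B : nat -> Prop) : Prop :=
  exists (F : seq nat) (m : nat) (E : 'I_m -> nat -> Prop),
    (forall j, exists r, (r <= k)%N /\ elementary_pnested p r (E j)) /\
    (forall n, B n <-> (n \in F \/ exists j, E j n)).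

Definition arith_prog (m t : nat) (n : nat) : Prop := exists u : nat, n = (m + t * u)%N.

Definition finite_symdiff (Z U : nat -> Prop) : Prop :=
  exists s : seq nat, forall n, n \notin s -> (Z n <-> U n).

Definition pnormal (p : nat) (k : nat) (Z : nat -> Prop) : Prop :=
  exists B : nat -> Prop, pnested p k B /\
  exists (s : nat) (A : 'I_s -> nat * nat),
    (forall i, (1 <= (A i).2)%N) /\
    finite_symdiff Z (fun n => B n \/ exists i, arith_prog (A i).1 (A i).2 n).

(* Main.v *)
Require Import Defs.
From Stdlib Require Import Classical_Prop.
From HB Require Import structures.
From mathcomp Require Import all_boot all_order all_fingroup all_algebra all_field.
From mathcomp Require Import ring zify.
Set Implicit Arguments. Unset Strict Implicit. Unset Printing Implicit Defensive.
Import Order.TTheory GRing.Theory Num.Theory.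
Local Open Scope ring_scope.

(** After splitting into residue classes the recurrence becomes a power sum
    [\sum_b c_b beta_b ^ n] with nonzero [c_b] and with no [beta_a / beta_b] a
    root of unity, so one studies, for a subspace [W] of [L ^ t], the set of the
    integers [n] with [(beta_b ^ n)_b] in [W]. Reading [n] in base [p] replaces
    [W] by the subspace of the [x] with [beta ^ m x ^ (p ^ k)] in [W], whose
    dimension does not increase. As long as it does not drop, the reduced echelon
    form [A] of [W] changes by [A_ib = rho_ib ^ m A'_ib ^ (p ^ k)] with
    [rho_ib = beta_b / beta_i], and over a finitely generated field only finitely
    many [A'] occur. So either the dimension drops in boundedly many steps along
    all digit strings, or some descendant satisfies [U = rho ^ j U ^ q], and then
    only one [p]-adic digit string keeps the dimension because [rho] is not
    infinitely [p]-divisible. In the latter case the set of [n] is generated from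
    sets attached to subspaces of lower dimension by iterating [n |-> q n + j],
    which adds one exponential term to each nested set. *)

(** * Fields with few iterated [p]-th roots *)

(** The bound [d - 2] is a count. On each residue class at most [d] terms survive, the vanishing of
    their sum describes a hyperplane of dimension at most [d - 1], and dimension [r] yields at most
    [r - 1] exponents, since dimension 1 gives a finite set. The finiteness of echelon forms is of
    Northcott type: if [x ^ (p ^ k)] is a polynomial of degree at most [l p ^ k] in fixed elements,
    the height of [x] is bounded independently of [k]. This property climbs from [F_p] through
    rational function fields and finite extensions, so it is available on a field containing the
    finitely many data. All integers are considered, not only the naturals, because of the main
    obstacle: iterating [n |-> q n + j] ties the exponents by inequalities, and freeing them uses
    linear dependence between power vectors whose exponents may be negative. The characteristic
    polynomial may have multiple roots or the root zero; passing to [p ^ d]-th powers absorbs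
    multiplicities, and a shift of the index removes zero. *)

Definition finite_pred (T : eqType) (P : T -> Prop) :=
  exists s : seq T, forall x, P x -> x \in s.

Lemma finite_sub (T : eqType) (P Q : T -> Prop) :
  (forall x, Q x -> P x) -> finite_pred P -> finite_pred Q.
Proof. by move=> QP [s sP]; exists s => x /QP /sP. Qed.

Lemma finite_image (T U : eqType) (f : T -> U) (P : T -> Prop) (Q : U -> Prop) :
  finite_pred P -> (forall y, Q y -> exists2 x, P x & y = f x) -> finite_pred Q.
Proof.
move=> [s sP] QP; exists (map f s) => y /QP[x Px ->].
by apply: map_f; apply: sP.
Qed.

Lemma finite_bigcup (T U : eqType) (P : T -> Prop) (Q : T -> U -> Prop) :
  finite_pred P -> (forall x, P x -> finite_pred (Q x)) ->
  finite_pred (fun y => exists2 x, P x & Q x y).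
Proof.
move=> [s sP] fQ.
suff [t tP]: finite_pred (fun y => exists2 x, x \in s & P x /\ Q x y).
  by exists t => y [x Px Qxy]; apply: tP; exists x => //; apply: sP.
elim: s {sP} => [|a s [t tP]]; first by exists [::] => y [].
have [Pa|nPa] := classic (P a); last first.
  exists t => y [x]; rewrite inE => /orP[/eqP-> [/nPa]//|xs PQ].
  by apply: tP; exists x.
have [u uP] := fQ a Pa; exists (u ++ t) => y [x]; rewrite inE mem_cat.
move=> /orP[/eqP-> [_ /uP->]//|xs PQ].
by apply/orP; right; apply: tP; exists x.
Qed.

Lemma finite_seqs (T : eqType) (P : T -> Prop) (n : nat) :
  finite_pred P ->
  finite_pred (fun s : seq T => size s = n /\ (forall x, x \in s -> P x)).
Proof.
move=> [s sP]; elim: n => [|n [S SP]].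
  by exists [:: [::]] => -[|x s'] [].
exists [seq x :: t | x <- s, t <- S] => -[[]//|x t [/= [szt] tP]].
apply/allpairsP; exists (x, t); split=> //=.
  by apply/sP/tP; rewrite mem_head.
by apply: SP; split=> // y yt; apply: tP; rewrite inE yt orbT.
Qed.

Lemma finite_matrices (R : nzRingType) (m n : nat) (P : 'I_m -> 'I_n -> R -> Prop) :
  (forall i j, finite_pred (P i j)) ->
  finite_pred (fun A : 'M[R]_(m, n) => forall i j, P i j (A i j)).
Proof.
move=> fP; pose Q (x : R) := exists2 ij : 'I_m * 'I_n, True & P ij.1 ij.2 x.
have fQ : finite_pred Q.
  apply: finite_bigcup => [|ij _]; last exact: fP.
  by exists (enum [set: 'I_m * 'I_n]) => x _; rewrite mem_enum inE.
pose f (s : seq R) : 'M[R]_(m, n) := \matrix_(i, j) s`_(mxvec_index i j).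
apply: (finite_image (f := f) (finite_seqs (m * n) fQ)) => A PA.
pose s := [seq mxvec A 0 k | k <- enum 'I_(m * n)].
have szs : size s = (m * n)%N by rewrite size_map size_enum_ord.
exists s; last first.
  apply/matrixP => i j; rewrite mxE (nth_map (mxvec_index i j)) ?size_enum_ord //.
  by rewrite nth_ord_enum mxvecE.
split=> // x /mapP[k _ ->]; case/mxvec_indexP: k => i j; rewrite mxvecE.
by exists (i, j).
Qed.

Lemma finite_polys (R : nzRingType) (P : R -> Prop) (n : nat) :
  finite_pred P ->
  finite_pred (fun f : {poly R} => (size f <= n)%N /\ (forall i, P f`_i)).
Proof.
move=> fP; apply: (finite_image (f := Poly) (finite_seqs n fP)) => f [szf Pf].
exists (mkseq (nth 0 f) n).
  by rewrite size_mkseq; split=> // x /mapP[i _ ->].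
apply/polyP => i; rewrite coef_Poly; have [ltin|lein] := ltnP i n.
  by rewrite nth_mkseq.
by rewrite [RHS]nth_default ?size_mkseq // nth_default // (leq_trans szf).
Qed.

Lemma finite_roots (F : fieldType) (f : {poly F}) : f != 0 -> finite_pred (root f).
Proof.
have [n] := ubnP (size f); elim: n f => // n IHn f szf f0.
have [[a fa]|nroot] := classic (exists a, root f a); last first.
  by exists [::] => x fx; case: nroot; exists x.
case/factor_theorem: fa f0 szf => g ->; rewrite mulf_eq0 polyXsubC_eq0 orbF => g0.
rewrite size_Mmonic ?monicXsubC // size_XsubC addn2 /= ltnS => szg.
have [s sP] := IHn g szg g0; exists (a :: s) => x.
by rewrite rootM root_XsubC inE => /orP[/sP->|->]//; rewrite orbT.
Qed.

(* [bounded_deg S N x]: [x] is the value at [S] of an integer polynomial of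
   degree at most [N]. *)
Inductive bounded_deg (R : nzRingType) (S : seq R) : nat -> R -> Prop :=
| bounded_deg1 N : bounded_deg S N 1
| bounded_degN N x : bounded_deg S N x -> bounded_deg S N (- x)
| bounded_degD N x y :
    bounded_deg S N x -> bounded_deg S N y -> bounded_deg S N (x + y)
| bounded_degM N x y :
    y \in S -> bounded_deg S N x -> bounded_deg S N.+1 (y * x).

Section BoundedDeg.
Variables (R : nzRingType) (S : seq R).
Local Notation bd := (bounded_deg S).

Lemma bounded_deg0 N : bd N 0.
Proof. by rewrite -(subrr 1); apply/bounded_degD/bounded_degN; apply: bounded_deg1. Qed.

Lemma bounded_degW M N x : (M <= N)%N -> bd M x -> bd N x.
Proof.
move=> leMN bx; elim: bx N leMN => {M x}.
- by move=> *; apply: bounded_deg1.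
- by move=> M x _ IH N leMN; apply/bounded_degN/IH.
- by move=> M x y _ IHx _ IHy N leMN; apply: bounded_degD; [apply: IHx|apply: IHy].
by move=> M x y yS _ IH [|N] // leMN; apply: bounded_degM => //; apply: IH.
Qed.

Lemma bounded_deg_sum (I : Type) (r : seq I) (P : pred I) (F : I -> R) N :
  (forall i, P i -> bd N (F i)) -> bd N (\sum_(i <- r | P i) F i).
Proof.
by move=> bF; apply: big_ind => //; [apply: bounded_deg0|move=> *; apply: bounded_degD].
Qed.

Lemma bounded_deg_mul M N x y : bd M x -> bd N y -> bd (M + N) (x * y).
Proof.
move=> bx; elim: bx N y => {M x}.
- by move=> M N y bY; rewrite mul1r; apply: bounded_degW bY; apply: leq_addl.
- by move=> M x _ IH N y bY; rewrite mulNr; apply/bounded_degN/IH.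
- move=> M x z _ IHx _ IHz N y bY; rewrite mulrDl.
  by apply: bounded_degD; [apply: IHx|apply: IHz].
by move=> M x z zS _ IH N y bY; rewrite -mulrA addSn; apply: bounded_degM => //; apply: IH.
Qed.

Lemma bounded_degX M x n : bd M x -> bd (n * M) (x ^+ n).
Proof.
move=> bx; elim: n => [|n IHn]; first exact: bounded_deg1.
by rewrite mulSn exprS; apply: bounded_deg_mul.
Qed.

End BoundedDeg.

Definition coef_bounded (R : nzRingType) (S : seq R) N (f : {poly R}) :=
  forall i, bounded_deg S N f`_i.

Section CoefBounded.
Variables (R : nzRingType) (S : seq R).
Local Notation cb := (coef_bounded S).

Lemma coef_boundedD N f g : cb N f -> cb N g -> cb N (f + g).
Proof. by move=> bf bg i; rewrite coefD; apply: bounded_degD. Qed.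

Lemma coef_boundedN N f : cb N f -> cb N (- f).
Proof. by move=> bf i; rewrite coefN; apply: bounded_degN. Qed.

Lemma coef_bounded0 N : cb N 0.
Proof. by move=> i; rewrite coef0; apply: bounded_deg0. Qed.

Lemma coef_boundedC N x : bounded_deg S N x -> cb N x%:P.
Proof.
by move=> bx i; rewrite coefC; case: eqP => _ //; apply: bounded_deg0.
Qed.

Lemma coef_boundedX N : cb N 'X.
Proof.
by move=> i; rewrite coefX; case: eqP => _; [apply: bounded_deg1|apply: bounded_deg0].
Qed.

Lemma coef_boundedM M N f g : cb M f -> cb N g -> cb (M + N) (f * g).
Proof.
by move=> bf bg i; rewrite coefM; apply: bounded_deg_sum => j _; apply: bounded_deg_mul.
Qed.

Lemma coef_bounded_prod (I : Type) (r : seq I) (F : I -> {poly R}) N :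
  (forall i, cb N (F i)) -> cb (size r * N) (\prod_(i <- r) F i).
Proof.
move=> bF; elim: r => [|i r IHr]; last first.
  by rewrite big_cons mulSn; apply: coef_boundedM.
by rewrite big_nil; apply/coef_boundedC/bounded_deg1.
Qed.

End CoefBounded.

(** Each product in the permutation expansion has [n] factors, whose coefficients have degree at
    most [N]. *)
Lemma coef_bounded_char_poly (R : comNzRingType) (S : seq R) n (M : 'M[R]_n) N :
  (forall i j, bounded_deg S N (M i j)) ->
  coef_bounded S (n * N) (char_poly M).
Proof.
move=> bM; rewrite /char_poly /determinant.
apply: big_ind => [||s _]; first exact: coef_bounded0.
  by move=> *; apply: coef_boundedD.
have bsM : coef_bounded S (n * N) (\prod_i char_poly_mx M i (s i)).
  have szI : size (index_enum 'I_n) = n by rewrite -[RHS](card_ord n) cardT enumT.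
  have := @coef_bounded_prod _ S _ (index_enum 'I_n)
    (fun i => char_poly_mx M i (s i)) N.
  rewrite szI; apply=> i; rewrite !mxE; apply: coef_boundedD.
    by case: eqP => _; [apply: coef_boundedX|apply: coef_bounded0].
  by apply/coef_boundedN/coef_boundedC.
case: (odd_perm s); last by rewrite expr0 mul1r.
by rewrite expr1 mulN1r; apply: coef_boundedN.
Qed.

(* The finiteness behind the descent. It fails in the perfect closure of
   [F_p(t)], as witnessed by the roots [t ^ (1 / p ^ k)]. *)
Definition height_finite (p : nat) (L : fieldType) := forall (S : seq L) (l : nat),
  finite_pred (fun x => exists k, bounded_deg S (l * p ^ k) (x ^+ (p ^ k))).

Section CharPolyFrobenius.
Variables (F : fieldType) (p : nat).
Hypothesis hp : p \in [pchar F].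

Let p_prime : prime p := pcharf_prime hp.

Lemma pchar_poly_pow (f : {poly F}) i : (f ^+ p)`_(i * p) = f`_i ^+ p.
Proof.
have hpP : p \in [pchar {poly F}] by rewrite pchar_poly.
elim/poly_ind: f i => [|f c IH] i.
  by rewrite expr0n coef0 expr0n; case: p p_prime => //= q; rewrite coef0.
rewrite -(pFrobenius_autE hpP) rmorphD rmorphM /= !pFrobenius_autE -polyC_exp.
rewrite coefD coefC coefMXn muln_eq0 [p == 0]eqn0Ngt prime_gt0 // orbF.
case: i => [|i]; rewrite coefD coefMX coefC /= ?add0r.
  by rewrite mul0n prime_gt0 // add0r.
by rewrite !addr0 mulSn ltnNge leq_addr /= addKn IH.
Qed.

(* The coefficients of the characteristic polynomial of [x] are [p]-th roots of
   those of [x ^ p], which is how finiteness passes to an algebraic extension. *)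
Lemma char_poly_frob n (M : 'M[F]_n.+1) i :
  (char_poly (M ^+ p))`_i = (char_poly M)`_i ^+ p.
Proof.
have hpM : p \in [pchar 'M[{poly F}]_n.+1].
  by apply: (rmorph_pchar (@scalar_mx {poly F} n.+1)); rewrite pchar_poly.
rewrite -pchar_poly_pow.
(* The scalar matrix ['X] commutes with [M], so Frobenius gives [('X - M) ^ p = 'X ^ p - M ^ p]; the
   determinant is multiplicative. *)
have -> : char_poly M ^+ p = (char_poly (M ^+ p)) \Po 'X^p.
  rewrite /char_poly -det_map_mx.
  have -> : \det (char_poly_mx M) ^+ p = \det (char_poly_mx M ^+ p).
    by elim: p => [|q IH]; rewrite ?expr0 ?det1 // !exprS [RHS]det_mulmx IH.
  congr (\det _); rewrite /char_poly_mx.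
  rewrite -(pFrobenius_autE hpM) pFrobenius_autB_comm; last first.
    by apply: comm_scalar_mx.
  rewrite !pFrobenius_autE map_mxB; congr (_ - _).
    by rewrite -rmorphXn /= map_scalar_mx /= comp_polyX.
  rewrite -rmorphXn /= -map_mx_comp; apply/matrixP => a b.
  by rewrite !mxE /= comp_polyC.
by rewrite coef_comp_poly_Xn ?prime_gt0 // dvdn_mull // mulnK ?prime_gt0.
Qed.

End CharPolyFrobenius.

Section CharPolyFrobeniusIter.
Variables (F : fieldType) (p : nat).
Hypothesis hp : p \in [pchar F].

Lemma char_poly_frob_iter n (M : 'M[F]_n.+1) k i :
  (char_poly (M ^+ (p ^ k)))`_i = (char_poly M)`_i ^+ (p ^ k).
Proof.
elim: k => [|k IHk]; first by rewrite expn0 !expr1.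
by rewrite expnSr [M ^+ _]exprM (char_poly_frob hp) IHk -exprM.
Qed.

Lemma pchar_poly_pow_iter (f : {poly F}) k i :
  (f ^+ (p ^ k))`_(i * p ^ k) = f`_i ^+ (p ^ k).
Proof.
elim: k i => [|k IHk] i; first by rewrite expn0 muln1 !expr1.
by rewrite expnSr mulnA [f ^+ _]exprM (pchar_poly_pow hp) IHk -exprM.
Qed.

End CharPolyFrobeniusIter.

Lemma char_poly_tr (R : nzRingType) n (A : 'M[R]_n) :
  char_poly_mx A^T = (char_poly_mx A)^T.
Proof. by apply/matrixP => i j; rewrite !mxE eq_sym. Qed.

(** * Finite extensions through the regular representation *)

Section FiniteExtension.
Variables (L E : fieldType) (iota : {rmorphism L -> E}) (p n : nat).
Variable v : 'cV[E]_n.+1.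
Hypothesis hp : p \in [pchar L].
Hypothesis v_free : forall u : 'rV[L]_n.+1, map_mx iota u *m v = 0 -> u = 0.
Hypothesis v_span : forall x : E, exists u : 'rV[L]_n.+1, (map_mx iota u *m v) 0 0 = x.

(** The regular representation: [M] is the matrix of multiplication by [x] in the basis [v] of [E]
    over [L]. *)
Let rep (x : E) (M : 'M[L]_n.+1) := map_mx iota M *m v = x *: v.

Let repE x : exists M, rep x M.
Proof.
have [f fP] := fin_all_exists (fun i : 'I_n.+1 => v_span (x * v i 0)).
exists (\matrix_i f i); apply/matrixP => i j; rewrite ord1 !mxE -fP mxE.
by apply: eq_bigr => k _; rewrite !mxE.
Qed.

Let rep_inj x M N : rep x M -> rep x N -> M = N.
Proof.
rewrite /rep => rM rN; apply/row_matrixP => i; apply/eqP; rewrite -subr_eq0.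
apply/eqP/v_free; rewrite -linearB /= map_row -row_mul map_mxB mulmxBl rM rN.
by rewrite subrr row0.
Qed.

Let repM x y M N : rep x M -> rep y N -> rep (x * y) (M * N).
Proof.
rewrite /rep => rM rN; rewrite map_mxM -mulmxA rN -scalemxAr rM.
by rewrite scalerA mulrC.
Qed.

Let rep1 : rep 1 1.
Proof. by rewrite /rep map_mx1 mul1mx scale1r. Qed.

Let repX x M k : rep x M -> rep (x ^+ k) (M ^+ k).
Proof.
move=> rM; elim: k => [|k IHk]; first exact: rep1.
by rewrite !exprS; apply: repM.
Qed.

Let rep_seq (S : seq E) : exists S' : seq L, forall y, y \in S ->
  exists M, rep y M /\ (forall i j, M i j \in S').
Proof.
elim: S => [|y S [S' S'P]]; first by exists [::].
have [M rM] := repE y; exists ([seq M ij.1 ij.2 | ij <- enum {: 'I_n.+1 * 'I_n.+1}] ++ S').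
move=> z; rewrite inE => /orP[/eqP->|/S'P[N [rN NP]]].
  exists M; split=> // i j; rewrite mem_cat; apply/orP; left.
  by apply/mapP; exists (i, j); rewrite ?mem_enum.
by exists N; split=> // i j; rewrite mem_cat NP orbT.
Qed.

(** Every [x] is a root of the characteristic polynomial of its matrix. The matrix of [x ^ (p ^ k)]
    has entries of bounded degree, hence so do the [p ^ k]-th powers of the coefficients of that
    polynomial, and finiteness over [L] leaves finitely many polynomials. *)
Lemma height_finite_ext : height_finite p L -> height_finite p E.
Proof.
move=> hL S l; have [S' S'P] := rep_seq S.
have rep_bd N y : bounded_deg S N y ->
    exists M, rep y M /\ (forall i j, bounded_deg S' N (M i j)).
  elim=> {N y}.
  - move=> N; exists 1; split=> // i j; rewrite !mxE.
    by case: eqP => _; [apply: bounded_deg1|apply: bounded_deg0].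
  - move=> N x _ [M [rM bM]]; exists (- M); rewrite /rep map_mxN mulNmx rM scaleNr.
    by split=> // i j; rewrite mxE; apply: bounded_degN.
  - move=> N x y _ [M [rM bM]] _ [M' [rM' bM']]; exists (M + M').
    rewrite /rep map_mxD mulmxDl rM rM' scalerDl; split=> // i j.
    by rewrite mxE; apply: bounded_degD.
  move=> N x y yS _ [M [rM bM]]; have [M' [rM' M'S]] := S'P _ yS.
  exists (M' * M); split; first exact: repM.
  by move=> i j; rewrite mxE; apply: bounded_deg_sum => k _; apply: bounded_degM.
have fpoly := finite_polys n.+2 (hL S' (n.+1 * l)%N).
pose Q (f : {poly L}) := f != 0 /\ ((size f <= n.+2)%N /\
  forall i, exists k, bounded_deg S' (n.+1 * l * p ^ k) (f`_i ^+ (p ^ k))).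
have fQ : finite_pred Q by apply: finite_sub fpoly => f [].
apply: finite_sub (finite_bigcup (Q := fun f => root (map_poly iota f)) fQ _); last first.
  by move=> f [f0 _]; apply: finite_roots; rewrite map_poly_eq0.
move=> x [k /rep_bd[M' [rM' bM']]]; have [M rM] := repE x.
have EM : M ^+ (p ^ k) = M' by apply: rep_inj rM'; apply: repX.
exists (char_poly M).
  split; first exact: monic_neq0 (char_poly_monic M).
  rewrite size_char_poly; split=> // i; exists k.
  by rewrite -(char_poly_frob_iter hp) EM -mulnA; apply: coef_bounded_char_poly.
(* The column [v] is an eigenvector with eigenvalue [x]; [eigenvalue] speaks of row vectors, hence
   the transposes. *)
rewrite map_char_poly /char_poly -det_tr -char_poly_tr -/(char_poly _).
rewrite -eigenvalue_root_char; apply/eigenvalueP; exists v^T.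
  by rewrite -trmx_mul rM linearZ.
apply/eqP => v0; have [u] := v_span 1.
by rewrite -(trmxK v) v0 trmx0 mulmx0 mxE => /esym/eqP; rewrite oner_eq0.
Qed.

End FiniteExtension.

(** * Rational function fields *)

Lemma fraction_div (R : idomainType) (x : {fraction R}) :
  exists ab : R * R, (ab.2 != 0) && (x == tofrac ab.1 / tofrac ab.2).
Proof.
elim/quotW: x => x; exists (frac x); rewrite denom_ratioP /=.
have d0 : tofrac (frac x).2 != 0 by rewrite tofrac_eq0 denom_ratioP.
apply/eqP/(mulIf d0); rewrite divfK //.
apply/eqP; rewrite !piE FracField.equivfE /FracField.mulf.
rewrite !numden_Ratio ?mulf_neq0 ?denom_ratioP ?oner_eq0 ?numden_Ratio ?oner_eq0 //.
by rewrite !mulr1 mulrC.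
Qed.

(** The universal property of the fraction field; injectivity of [f] keeps the images of
    denominators nonzero. *)
Lemma fraction_lift (R : idomainType) (K : fieldType) (f : {rmorphism R -> K}) :
  (forall a, f a = 0 -> a = 0) ->
  exists g : {rmorphism {fraction R} -> K}, forall a, g (tofrac a) = f a.
Proof.
move=> f_inj; pose nd (x : {fraction R}) : R * R := xchoose (fraction_div x).
pose g (x : {fraction R}) := f (nd x).1 / f (nd x).2.
have gE x a b : b != 0 -> x = tofrac a / tofrac b -> g x = f a / f b.
  move=> b0 xE; have /andP[d0 /eqP xE'] := xchooseP (fraction_div x).
  rewrite -/(nd x) in d0 xE'; rewrite /g.
  have fb0 : f b != 0 by apply: contraNneq b0 => /f_inj->.
  have fd0 : f (nd x).2 != 0 by apply: contraNneq d0 => /f_inj->.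
  apply/eqP; rewrite eqr_div // -!rmorphM; apply/eqP; congr (f _).
  apply/eqP; rewrite -tofrac_eq !rmorphM /= -eqr_div ?tofrac_eq0 //.
  by rewrite -xE' -xE.
have xP x : exists a b, [/\ b != 0, f b != 0 & x = tofrac a / tofrac b].
  have [[a b] /= /andP[b0 /eqP xE]] := fraction_div x.
  by exists a, b; split=> //; apply: contraNneq b0 => /f_inj->.
have g_add : zmod_morphism g.
  move=> x y; have [a [b [b0 fb0 xE]]] := xP x; have [c [d [d0 fd0 yE]]] := xP y.
  rewrite (gE x a b) // (gE y c d) // (gE _ (a * d - c * b) (b * d)); last first.
  - by rewrite xE yE -mulNr addf_div ?tofrac_eq0 // mulNr rmorphB !rmorphM.
  - by rewrite mulf_neq0.
  by rewrite rmorphB !rmorphM /=; field; rewrite fb0 fd0.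
have g_mul : monoid_morphism g.
  split; first by rewrite (gE 1 1 1) ?oner_eq0 ?rmorph1 ?divr1.
  move=> x y; have [a [b [b0 fb0 xE]]] := xP x; have [c [d [d0 fd0 yE]]] := xP y.
  rewrite (gE x a b) // (gE y c d) // (gE _ (a * c) (b * d)); last first.
  - by rewrite xE yE mulf_div !rmorphM.
  - by rewrite mulf_neq0.
  by rewrite !rmorphM /=; field; rewrite fb0 fd0.
pose gA := GRing.isZmodMorphism.Build _ _ g g_add.
pose gM := GRing.isMonoidMorphism.Build _ _ g g_mul.
pose G : {rmorphism {fraction R} -> K} := HB.pack g gA gM.
exists G => a; rewrite /G /= (gE _ a 1) ?oner_eq0 ?rmorph1 ?divr1 //.
Qed.

(** With a common denominator [D] of [S], an element of degree at most [M] in [S] is a polynomial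
    over [D ^ M]. So [x D ^ l] has a polynomial as its [p ^ k]-th power, hence is itself a
    polynomial, of bounded size and with coefficients covered by the finiteness over [L]. *)
Lemma height_finite_quotients (L E : fieldType) (tf : {rmorphism {poly L} -> E}) p :
  (forall f, (tf f == 0) = (f == 0)) ->
  (forall x, exists ab : {poly L} * {poly L}, (ab.2 != 0) && (x == tf ab.1 / tf ab.2)) ->
  p \in [pchar L] -> height_finite p L -> height_finite p E.
Proof.
move=> tf_eq0 tf_div hp hL S l.
have tf_eq f g : (tf f == tf g) = (f == g) by rewrite -subr_eq0 -rmorphB tf_eq0 subr_eq0.
 have p_gt0 : (0 < p)%N by rewrite prime_gt0 // (pcharf_prime hp).
have [D [fs [D0 fsP]]] : exists (D : {poly L}) (fs : seq {poly L}),
    D != 0 /\ forall y, y \in S -> exists2 f, f \in fs & y = tf f / tf D.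
  elim: S => [|y S [D [fs [D0 fsP]]]]; first by exists 1, [::]; rewrite oner_eq0.
  have [[a b] /= /andP[b0 /eqP yE]] := tf_div y.
  exists (D * b), (a * D :: [seq f * b | f <- fs]); split; first by rewrite mulf_neq0.
  move=> z; rewrite inE => /orP[/eqP->|/fsP[f fP ->]].
    exists (a * D); first by rewrite mem_head.
    by rewrite yE !rmorphM /= [tf a * tf D]mulrC -mulf_div divff ?tf_eq0 // mul1r.
  exists (f * b); first by rewrite inE (map_f (fun f => f * b)) ?orbT.
  by rewrite !rmorphM /= -mulf_div divff ?tf_eq0 // mulr1.
(* The extra [0] accounts for coefficients beyond the size of a polynomial. *)
pose S' : seq L := 0 :: flatten [seq polyseq f | f <- D :: fs].
pose N := \max_(f <- D :: fs) size f.
have Dfs f : f \in D :: fs -> (size f <= N.+1)%N /\ forall i, f`_i \in S'.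
  move=> fP; split; first by apply/leqW/leq_bigmax_seq.
  move=> i; rewrite inE; have [lti|le] := ltnP i (size f); last first.
    by rewrite nth_default ?eqxx.
  apply/orP; right; apply/flattenP; exists (polyseq f); last exact: mem_nth.
  exact: map_f.
have [sD cD] := Dfs D (mem_head _ _).
have S'P y : y \in S -> exists f : {poly L},
    [/\ y = tf f / tf D, (size f <= N.+1)%N & forall i, f`_i \in S'].
  case/fsP=> f fP yE; have [|sf cf] := Dfs f; first by rewrite inE fP orbT.
  by exists f.
have num_bd M y : bounded_deg S M y -> exists P : {poly L},
    [/\ y = tf P / tf D ^+ M, (size P <= N * M + 1)%N & coef_bounded S' M P].
  have coef_bounded_seq (f : {poly L}) : (forall i, f`_i \in S') -> coef_bounded S' 1 f.
    by move=> cf i; rewrite -[f`_i]mulr1; apply: bounded_degM => //; apply: bounded_deg1.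
  have tD : tf D != 0 by rewrite tf_eq0.
  elim=> {M y}.
  - move=> M; exists (D ^+ M); rewrite rmorphXn /= divff ?expf_neq0 //; split=> //.
      apply: leq_trans (size_poly_exp_leq _ _) _.
      by rewrite addn1 ltnS leq_mul // -subn1 leq_subLR add1n.
    elim: M => [|M IH]; first by rewrite expr0; apply/coef_boundedC/bounded_deg1.
    by rewrite exprS -addn1 addnC; apply: coef_boundedM => //; apply: coef_bounded_seq.
  - move=> M y _ [P [yE sP cP]]; exists (- P); split; last exact: coef_boundedN.
      by rewrite yE rmorphN mulNr.
    by rewrite size_polyN.
  - move=> M y z _ [P [yE sP cP]] _ [Q [zE sQ cQ]]; exists (P + Q).
    split; last exact: coef_boundedD.
      by rewrite yE zE rmorphD mulrDl.
    by apply: leq_trans (size_polyD _ _) _; rewrite geq_max sP sQ.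
  move=> M y z /S'P[f [fE sf cf]] _ [P [yE sP cP]]; exists (f * P); split.
  - by rewrite yE fE rmorphM exprS mulf_div.
  - by apply: leq_trans (size_polyMleq _ _) _; move: (size f) (size P) sf sP => u w; clear; lia.
  by rewrite -add1n; apply: coef_boundedM => //; apply: coef_bounded_seq.
have fpoly := finite_polys (N * l + 1) (hL S' l).
apply: (finite_image (f := fun h => tf h / tf D ^+ l) fpoly) => x [k].
set q := (p ^ k)%N => /num_bd[P [xE sP cP]].
have q_gt0 : (0 < q)%N by rewrite expn_gt0 p_gt0.
have tDl : tf D ^+ l != 0 by rewrite expf_neq0 // tf_eq0.
have zE : (x * tf D ^+ l) ^+ q = tf P.
  by rewrite exprMn xE -exprM divfK // expf_neq0 // tf_eq0.
have [[a b] /= /andP[b0 /eqP abE]] := tf_div (x * tf D ^+ l).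
have tb : tf b != 0 by rewrite tf_eq0.
(* Polynomials over a field are integrally closed: [b ^ q] divides [a ^ q], hence [b] divides
   [a]. *)
have b_dv_a : b %| a.
  rewrite -(dvdp_pexp2r _ _ q_gt0); apply/dvdpP; exists P; apply/eqP.
  rewrite -tf_eq rmorphM !rmorphXn /= -zE abE exprMn exprVn.
  by rewrite divfK // expf_neq0.
case/dvdpP: b_dv_a => h aE; exists h; last first.
  by apply: (mulIf tDl); rewrite divfK // abE aE rmorphM mulfK.
have hP : h ^+ q = P.
  by apply/eqP; rewrite -tf_eq rmorphXn /= -zE abE aE rmorphM mulfK.
split=> [|i]; last by exists k; rewrite -(pchar_poly_pow_iter hp) -/q hP.
move: sP; rewrite -hP; have [->|h0] := eqVneq h 0; first by rewrite size_poly0.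
rewrite !addn1 [size (h ^+ q)]polySpred ?expf_neq0 // size_exp [size h]polySpred //.
by rewrite /= !ltnS mulnA leq_pmul2r.
Qed.

Lemma height_finite_fraction (L : fieldType) (p : nat) :
  p \in [pchar L] -> height_finite p L -> height_finite p {fraction {poly L}}.
Proof.
apply: (height_finite_quotients (tf := @tofrac {poly L})); last exact: fraction_div.
exact: tofrac_eq0.
Qed.

Lemma height_finite_fieldExt (F : fieldType) (E : fieldExtType F) (p : nat) :
  p \in [pchar F] -> height_finite p F -> height_finite p E.
Proof.
move=> hp hF; have [n] : exists n, \dim {:E} = n by exists (\dim {:E}).
case: n => [|n] dimE.
  have := oner_neq0 E; suff -> : (1 : E) = 0 by rewrite eqxx.
  by apply/eqP; rewrite -memv0 -(eqP (_ : fullv == 0%VS)) ?memvf // -dimv_eq0 dimE.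
have [X XB] : exists X : n.+1.-tuple E, basis_of {:E} X.
  by rewrite -dimE; exists (vbasis fullv); apply: vbasisP.
have vE (u : 'rV[F]_n.+1) :
  (map_mx (in_alg E) u *m (\col_i X`_i)) 0 0 = \sum_i u 0 i *: X`_i.
  by rewrite mxE; apply: eq_bigr => i _; rewrite !mxE mulr_algl.
apply: (height_finite_ext (iota := in_alg E) (v := \col_i X`_i) hp) hF => [u u0|x].
  have sum0 : \sum_i u 0 i *: X`_i = 0.
    apply: etrans (esym (vE u)) _.
    exact: etrans (congr1 (fun A : 'M_1 => A 0 0) u0) (mxE _ _ _ _).
  by apply/rowP => i; rewrite (freeP (basis_free XB) _ sum0) mxE.
exists (\row_i coord X i x); apply: etrans (vE _) _.
rewrite [RHS](coord_basis XB (memvf x)); apply: eq_bigr => i _.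
by rewrite mxE.
Qed.

Lemma height_finite_Fp (p : nat) : height_finite p 'F_p.
Proof. by move=> S l; exists (enum 'F_p) => x _; rewrite mem_enum. Qed.

Lemma exists_minn (P : nat -> Prop) : (exists n, P n) ->
  exists n, P n /\ forall m, P m -> (n <= m)%N.
Proof.
move=> [n Pn]; elim/ltn_ind: n Pn => n IHn Pn.
have [[m [Pm ltmn]]|nm] := classic (exists m, P m /\ (m < n)%N); first exact: IHn Pm.
by exists n; split=> // m Pm; rewrite leqNgt; apply/negP => ltmn; case: nm; exists m.
Qed.

(** Elements are adjoined one at a time: a transcendental one gives a rational function field, an
    algebraic one a simple extension. The descent takes place in [L] because [K] itself may contain
    infinitely many iterated [p]-th roots of one element. *)
Lemma height_finite_cover (K : fieldType) (p : nat) (s : seq K) :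
  p \in [pchar K] ->
  exists (L : fieldType) (iota : {rmorphism L -> K}),
    [/\ p \in [pchar L], height_finite p L & forall x, x \in s -> exists y, iota y = x].
Proof.
move=> hp; have p_pr := pcharf_prime hp.
elim: s => [|x s [L [iota [hpL hL sL]]]].
  pose A := pPrimeCharType hp.
  pose f : {rmorphism 'F_p -> A} := in_alg A.
  exists 'F_p, f.
  by split=> //; [apply: pchar_Fp|apply: height_finite_Fp].
have [[f f0 fx]|x_tr] := classic (exists2 f, f != 0 & root (map_poly iota f) x); last first.
  pose ev : {rmorphism {poly L} -> K} := horner_eval x \o map_poly iota.
  have ev_inj f : ev f = 0 -> f = 0.
    move=> fx; have [//|f0] := eqVneq f 0; case: x_tr; exists f => //.
    by apply/rootP.
  have [g gE] := fraction_lift ev_inj.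
  have hpP : p \in [pchar {poly L}] by rewrite pchar_poly.
  exists {fraction {poly L}}, g; split.
  - exact: (rmorph_pchar (@tofrac {poly L}) hpP).
  - exact: height_finite_fraction.
  move=> y; rewrite inE => /orP[/eqP->|/sL[z <-]].
    by exists (tofrac 'X); rewrite gE /= map_polyX /horner_eval hornerX.
  by exists (tofrac z%:P); rewrite gE /= map_polyC /horner_eval hornerC.
have [n [[g [g0 gx <-]] g_min]] : exists n, (exists g : {poly L},
    [/\ g != 0, root (map_poly iota g) x & size g = n]) /\
    forall m, (exists g : {poly L}, [/\ g != 0, root (map_poly iota g) x & size g = m]) ->
    (n <= m)%N.
  by apply: exists_minn; exists (size f), f.
have g_irr : irreducible_poly g.
  apply/(subfx_irreducibleP gx) => // q qx q0; apply: g_min; by exists q.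
pose E := SubFieldExtType gx g_irr.
exists E, (@subfx_inj _ _ iota x g : {rmorphism E -> K}); split.
- exact: (rmorph_pchar (in_alg E) hpL).
- exact: height_finite_fieldExt.
move=> y; rewrite inE => /orP[/eqP->|/sL[z <-]].
  by exists (subfx_root iota x g); apply: subfx_inj_root.
by exists (in_alg E z); apply: subfx_inj_base.
Qed.

(** * Nested sets of integers *)

(** The value reached from 0 after [k] iterations of [n |-> q n + 1]. *)
Definition geo (q k : nat) : nat := (\sum_(i < k) q ^ i)%N.

Lemma geo0 q : geo q 0 = 0%N.
Proof. by rewrite /geo big_ord0. Qed.

Lemma geoS q k : geo q k.+1 = (q * geo q k + 1)%N.
Proof.
rewrite /geo big_ord_recl expn0 addnC; congr (_ + _)%N.
by rewrite big_distrr; apply: eq_bigr => i _; rewrite expnS.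
Qed.

Lemma geoSr q k : geo q k.+1 = (geo q k + q ^ k)%N.
Proof. by rewrite /geo big_ord_recr. Qed.

Lemma geo_comp q a k s :
  geo q (a * k + s) = (q ^ s * geo q a * geo (q ^ a) k + geo q s)%N.
Proof.
have geoD x y : geo q (x + y) = (q ^ y * geo q x + geo q y)%N.
  elim: y => [|y IH]; first by rewrite addn0 geo0 expn0 mul1n addn0.
  by rewrite addnS !geoS IH expnS; ring.
have geoM : geo q (a * k) = (geo q a * geo (q ^ a) k)%N.
  elim: k => [|k IH]; first by rewrite muln0 !geo0 muln0.
  by rewrite mulnS addnC geoD geoS IH; ring.
by rewrite geoD geoM; ring.
Qed.

Lemma geo_pred q k : (0 < q)%N -> ((q - 1) * geo q k + 1 = q ^ k)%N.
Proof.
move=> q0; elim: k => [|k IH]; first by rewrite geo0 muln0 expn0.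
by rewrite geoS expnS -IH; case: q q0 {IH} => // q _; rewrite subn1 /=; ring.
Qed.

(* The integers [C + \sum_i c_i (q ^ k_i - 1) / (q - 1)]: the elementary nested
   sets in a parametrization with integer coefficients, before intersecting
   with the naturals. *)
Fixpoint geo_points (q : nat) (C : int) (cs : seq int) (n : int) : Prop :=
  if cs is c :: cs' then exists k, geo_points q (C + c * (geo q k)%:Z) cs' n
  else n = C.

Fixpoint geo_points_ge (l q : nat) (C : int) (cs : seq int) (n : int) : Prop :=
  if cs is c :: cs' then
    exists2 k, (l <= k)%N & geo_points_ge l q (C + c * (geo q k)%:Z) cs' n
  else n = C.

Section GeoPoints.
Variable q : nat.
Local Notation pts := (geo_points q).
Local Notation pts_ge := (fun l => geo_points_ge l q).

Lemma geo_points_ge0 C cs n : geo_points_ge 0 q C cs n <-> pts C cs n.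
Proof.
elim: cs C => [|c cs IH] C //=; split=> [[k _]|[k]] /IH; first by exists k.
by exists k.
Qed.

Lemma geo_points_shift t C cs n : pts C cs n -> pts (C + t) cs (n + t).
Proof.
elim: cs C => [|c cs IH] C /= => [->//|[k /IH nP]]; exists k.
by rewrite addrAC.
Qed.

Lemma geo_points_affine m P C cs n :
  pts C cs n -> pts (m + P * C) (map ( *%R P) cs) (m + P * n).
Proof.
elim: cs C => [|c cs IH] C /= => [->//|[k /IH nP]]; exists k.
by move: nP; rewrite mulrDr mulrA addrA.
Qed.

Lemma geo_points_affine_inv m P C cs y :
  pts (m + P * C) (map ( *%R P) cs) y -> exists n, y = m + P * n /\ pts C cs n.
Proof.
elim: cs C => [|c cs IH] C /= => [->|[k yP]]; first by exists C.
have [n [yE nP]] : exists n, y = m + P * n /\ pts (C + c * (geo q k)%:Z) cs n.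
  by apply: IH; move: yP; rewrite mulrDr mulrA addrA.
by exists n; split=> //; exists k.
Qed.

(** Since [geo q k.+1 = q * geo q k + 1], raising every exponent by one multiplies by [q] and adds
    each coefficient once; the subtracted sum compensates for this. *)
Lemma geo_points_frob J C cs n :
  pts C cs n -> pts (q%:Z * C - \sum_(c <- cs) c + J) cs (q%:Z * n + J).
Proof.
elim: cs C => [|c cs IH] C /=; first by move=> ->; rewrite big_nil subr0.
case=> k /IH nP; exists k.+1; move: nP; rewrite big_cons geoS.
by congr geo_points; rewrite PoszD PoszM; ring.
Qed.

Lemma geo_points_ge_frob_inv l J C cs n :
  geo_points_ge l.+1 q (q%:Z * C - \sum_(c <- cs) c + J) cs n ->
  exists n', geo_points_ge l q C cs n' /\ n = q%:Z * n' + J.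
Proof.
elim: cs C => [|c cs IH] C /=.
  by rewrite big_nil subr0 => ->; exists C.
case=> -[|k] // lek nP.
have [n' [n'P nE]] : exists n', geo_points_ge l q (C + c * (geo q k)%:Z) cs n' /\
    n = q%:Z * n' + J.
  apply: IH; move: nP; rewrite big_cons geoS.
  by congr geo_points_ge; rewrite PoszD PoszM; ring.
by exists n'; split=> //; exists k.
Qed.

(** Exponents are sorted by their residue modulo [a]: by [geo_comp], [geo q (a * k + s)] is affine
    in [geo (q ^ a) k]. The number of exponents does not change. *)
Lemma geo_points_refine a cs : (0 < a)%N -> exists l : seq (int * seq int),
  (forall x, x \in l -> size x.2 = size cs) /\
  forall C n, pts C cs n <-> exists2 x, x \in l & geo_points (q ^ a) (C + x.1) x.2 n.
Proof.
move=> a0; elim: cs => [|c cs [l [sl lP]]].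
  exists [:: (0, [::])]; split=> [x|C n]; first by rewrite inE => /eqP->.
  split=> [/= ->|[x]]; first by exists (0, [::]); rewrite ?inE //= addr0.
  by rewrite inE => /eqP->; rewrite /= addr0.
pose g s (x : int * seq int) : int * seq int :=
  (c * (geo q s)%:Z + x.1, c * (q ^ s * geo q a)%N%:Z :: x.2).
exists [seq g s x | s <- iota 0 a, x <- l]; split=> [x|C n].
  by case/allpairsP=> -[s y] [/= _ /sl yl ->] /=; rewrite yl.
have gE C' s x k : C' + c * (geo q (a * k + s))%:Z + x.1 =
   C' + (c * (geo q s)%:Z + x.1) + c * (q ^ s * geo q a)%N%:Z * (geo (q ^ a) k)%:Z :> int.
  by rewrite geo_comp PoszD !PoszM; ring.
split=> [[k /lP[x xl xP]]|[_ /allpairsP[[s x] [/= sa xl ->]] /= [k xP]]].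
  exists (g (k %% a)%N x).
    by apply/allpairsP; exists ((k %% a)%N, x); rewrite mem_iota ltn_mod.
  by exists (k %/ a)%N; rewrite -gE mulnC -divn_eq.
by exists (a * k + s)%N; apply/lP; exists x; rewrite // gE.
Qed.

End GeoPoints.

(** The strict bound makes [r] comparable to the dimension of a subspace: [r = 0] allows only the
    empty set, [r = 1] only finite sets. *)
Definition nested_at (q r : nat) (Z : int -> Prop) :=
  exists l : seq (int * seq int), (forall x, x \in l -> (size x.2 < r)%N) /\
    forall n, Z n <-> exists2 x, x \in l & geo_points q x.1 x.2 n.

Definition nested (p r : nat) (Z : int -> Prop) :=
  exists2 e, (0 < e)%N & nested_at (p ^ e) r Z.

Section Nested.
Variables (p r : nat).

Lemma nested_at_ext q (Z Z' : int -> Prop) :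
  (forall n, Z n <-> Z' n) -> nested_at q r Z -> nested_at q r Z'.
Proof.
by move=> ZZ' [l [lr lP]]; exists l; split=> // n; rewrite -ZZ'; apply: lP.
Qed.

Lemma nested_ext (Z Z' : int -> Prop) :
  (forall n, Z n <-> Z' n) -> nested p r Z -> nested p r Z'.
Proof. by move=> ZZ' [e e0 Ze]; exists e => //; apply: nested_at_ext Ze. Qed.

Lemma nested_at_refine q a Z : (0 < a)%N -> nested_at q r Z -> nested_at (q ^ a) r Z.
Proof.
move=> a0 [l [lr lP]]; suff [l' [lr' lP']] : nested_at (q ^ a) r
    (fun n => exists2 x, x \in l & geo_points q x.1 x.2 n).
  by exists l'; split=> // n; rewrite lP.
elim: l lr {lP} => [|x l IH] lr.
  by exists [::]; split=> // n; split=> -[].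
have [|l1 [lr1 lP1]] := IH; first by move=> y yl; apply: lr; rewrite inE yl orbT.
have [l2 [lr2 lP2]] := geo_points_refine q x.2 a0.
exists ([seq (x.1 + y.1, y.2) | y <- l2] ++ l1); split=> [y|n].
  rewrite mem_cat => /orP[/mapP[z /lr2 zx ->]|/lr1 //] /=.
  by rewrite zx; apply: lr; rewrite mem_head.
split=> [[y]|[y]].
  rewrite inE => /orP[/eqP-> /lP2[z zl zP]|yl yP].
    by exists (x.1 + z.1, z.2); rewrite // mem_cat map_f.
  have [|z zl zP] := (lP1 n).1; first by exists y.
  by exists z; rewrite // mem_cat zl orbT.
rewrite mem_cat => /orP[/mapP[z zl ->] /= zP|yl yP].
  by exists x; rewrite ?mem_head //; apply/lP2; exists z.
have [|z zl zP] := (lP1 n).2; first by exists y.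
by exists z; rewrite // inE zl orbT.
Qed.

Lemma nested_at_union q Z1 Z2 : nested_at q r Z1 -> nested_at q r Z2 ->
  nested_at q r (fun n => Z1 n \/ Z2 n).
Proof.
move=> [l1 [lr1 lP1]] [l2 [lr2 lP2]]; exists (l1 ++ l2); split=> [x|n].
  by rewrite mem_cat => /orP[/lr1|/lr2].
split=> [[/lP1|/lP2] [x xl xP]|[x]].
- by exists x; rewrite // mem_cat xl.
- by exists x; rewrite // mem_cat xl orbT.
by rewrite mem_cat => /orP[xl|xl] xP; [left; apply/lP1|right; apply/lP2]; exists x.
Qed.

Lemma nested_at_empty q (Z : int -> Prop) : (forall n, ~ Z n) -> nested_at q r Z.
Proof. by move=> Z0; exists [::]; split=> // n; split=> [/Z0|[]]. Qed.

Lemma nested_empty (Z : int -> Prop) : (forall n, ~ Z n) -> nested p r Z.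
Proof. by exists 1%N => //; apply: nested_at_empty. Qed.

Lemma nested_at_affine q m P Z : nested_at q r Z ->
  nested_at q r (fun y => exists2 n, Z n & y = m + P * n).
Proof.
move=> [l [lr lP]]; exists [seq (m + P * x.1, map ( *%R P) x.2) | x <- l].
split=> [_ /mapP[x /lr xr ->]|y]; first by rewrite size_map.
split=> [[n /lP[x xl xP] ->]|[_ /mapP[x xl ->] /= /geo_points_affine_inv[n [-> nP]]]].
  by exists (m + P * x.1, map ( *%R P) x.2); [apply: map_f|apply: geo_points_affine].
by exists n => //; apply/lP; exists x.
Qed.

Lemma nested_at_bigcup q (I : eqType) (s : seq I) (F : I -> int -> Prop) :
  (forall i, i \in s -> nested_at q r (F i)) ->
  nested_at q r (fun n => exists2 i, i \in s & F i n).
Proof.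
elim: s => [|i s IH] sF; first by apply: nested_at_empty => n [].
apply: nested_at_ext (nested_at_union (sF i (mem_head _ _)) (IH _)) => [n|j js]; last first.
  by apply: sF; rewrite inE js orbT.
split=> [[Fi|[j js Fj]]|[j]]; first by exists i; rewrite ?mem_head.
  by exists j; rewrite // inE js orbT.
by rewrite inE => /orP[/eqP->|js] Fj; [left|right; exists j].
Qed.

Lemma nested_union Z1 Z2 : nested p r Z1 -> nested p r Z2 ->
  nested p r (fun n => Z1 n \/ Z2 n).
Proof.
move=> [e e0 Z1e] [f f0 Z2f]; exists (e * f)%N; first by rewrite muln_gt0 e0.
apply: nested_at_union; first by rewrite expnM; apply: nested_at_refine.
by rewrite mulnC expnM; apply: nested_at_refine.
Qed.

Lemma nested_affine m P Z : nested p r Z ->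
  nested p r (fun y => exists2 n, Z n & y = m + P * n).
Proof. by move=> [e e0 Ze]; exists e => //; apply: nested_at_affine. Qed.

Lemma nested_bigcup (I : eqType) (s : seq I) (F : I -> int -> Prop) :
  (forall i, i \in s -> nested p r (F i)) ->
  nested p r (fun n => exists2 i, i \in s & F i n).
Proof.
elim: s => [|i s IH] sF; first by apply: nested_empty => n [].
apply: nested_ext (nested_union (sF i (mem_head _ _)) (IH _)) => [n|j js]; last first.
  by apply: sF; rewrite inE js orbT.
split=> [[Fi|[j js Fj]]|[j]]; first by exists i; rewrite ?mem_head.
  by exists j; rewrite // inE js orbT.
by rewrite inE => /orP[/eqP->|js] Fj; [left|right; exists j].
Qed.

End Nested.

Lemma nestedW p r r' Z : (r <= r')%N -> nested p r Z -> nested p r' Z.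
Proof.
move=> le [e e0 [l [lr lP]]]; exists e => //; exists l; split=> // x /lr xr.
exact: leq_trans xr le.
Qed.

(** A stand-in for being cut out by linear conditions on power vectors: [hits_geo_closed] proves it
    for such sets, whereas a set of integers may well fail it. *)
Definition geo_closed (p : nat) (Z : int -> Prop) := forall e C c k0, (0 < e)%N ->
  (forall k, (k0 <= k)%N -> Z (C + c * (geo (p ^ e) k)%:Z)) ->
  forall k, Z (C + c * (geo (p ^ e) k)%:Z).

(* Nested sets have independent exponents, whereas iterating [n |-> q n + j] [l]
   times only yields exponents [>= l]; for closed sets the constraint can be
   dropped. *)
Lemma geo_points_closed p e Z l C cs : (0 < e)%N -> geo_closed p Z ->
  (forall n, geo_points_ge l (p ^ e) C cs n -> Z n) ->
  forall n, geo_points (p ^ e) C cs n -> Z n.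
Proof.
move=> e0 Zcl; elim: cs C => [|c cs IH] C //= ZP n [k nP].
set q := (p ^ e)%N in nP *.
(* With the other exponents frozen, [n] moves along [D + c * geo q k']; the points with [k' >= l]
   lie in [Z], and closedness along this line gives the one at [k]. *)
pose D := C + (n - (C + c * (geo q k)%:Z)).
have -> : n = D + c * (geo q k)%:Z by rewrite /D; ring.
apply: (Zcl e D c l e0) => k' lk'; rewrite -/q.
apply: (IH (C + c * (geo q k')%:Z)) => [m mP|]; first by apply: ZP; exists k'.
have := geo_points_shift (c * (geo q k')%:Z - c * (geo q k)%:Z) nP.
by congr geo_points; rewrite /D; ring.
Qed.

(** Unrolling the equation [k] times sends a point of [X] through [k] similarities, and [k] becomes
    the one new exponent. Every point of [Z] arises in this way except possibly a fixed point of the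
    similarity, as undoing a step brings a point closer to it. *)
Lemma nested_selfsimilar p r e j (Z X : int -> Prop) :
  (1 < p)%N -> (0 < e)%N -> geo_closed p Z -> nested p r X ->
  (forall n, Z n <-> X n \/ exists2 n', Z n' & n = j + (p ^ e)%N%:Z * n') ->
  nested p r.+1 Z.
Proof.
move=> p1 e0 Zcl [a a0 Xa] ZE; set q := (p ^ e)%N in ZE.
pose J := j * (geo q a)%:Z; pose Q := (p ^ (e * a))%N.
have QE : Q = (q ^ a)%N by rewrite /Q expnM.
have ZEs s n : Z n <-> (exists2 i, i \in iota 0 s &
      exists2 x, X x & n = j * (geo q i)%:Z + (q ^ i)%N%:Z * x) \/
    exists2 n', Z n' & n = j * (geo q s)%:Z + (q ^ s)%N%:Z * n'.
  elim: s n => [|s IH] n.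
    split=> [Zn|[[]//|[n' Zn' ->]]].
      by right; exists n; rewrite // geo0 expn0 mulr0 add0r mul1r.
    by rewrite geo0 expn0 mulr0 add0r mul1r.
  split=> [/IH[[i]|[n' /ZE[Xn'|[n'' Zn'' ->]] ->]]|].
  - rewrite mem_iota => /andP[_ lti] xP; left; exists i => //.
    by rewrite mem_iota /= add0n ltnW.
  - by left; exists s; [rewrite mem_iota /= add0n|exists n'].
  - by right; exists n''; rewrite // geoSr expnSr PoszD !PoszM; ring.
  case=> [[i]|[n' Zn' ->]].
    rewrite mem_iota /= add0n ltnS leq_eqVlt => /orP[/eqP->|lti] [x Xx ->]; apply/IH.
      by right; exists x => //; apply/ZE; left.
    by left; exists i; [rewrite mem_iota|exists x].
  apply/IH; right; exists (j + q%:Z * n'); first by apply/ZE; right; exists n'.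
  by rewrite geoSr expnSr PoszD !PoszM; ring.
pose X' n := exists2 i, i \in iota 0 a &
      exists2 x, X x & n = j * (geo q i)%:Z + (q ^ i)%N%:Z * x.
have X'Z n : X' n -> Z n by move=> X'n; apply/(ZEs a); left.
have ZQ n : Z n -> Z (Q%:Z * n + J).
  by move=> Zn; apply/(ZEs a); right; exists n; rewrite // -QE -/J addrC.
have [l [lr lP]] : nested_at Q r X'.
  apply: nested_at_bigcup => i _; apply: nested_at_affine.
  by rewrite /Q mulnC expnM; apply: nested_at_refine.
(* One similarity moves the constant [C] to [Q C - sum c + J], that is, by [(Q - 1) C + J - sum c];
   [k] of them move it by [geo Q k] times this number, which is thus the coefficient of the new
   exponent. *)
pose g (x : int * seq int) : int * seq int :=
  (x.1, (Q%:Z - 1) * x.1 + J - \sum_(c <- x.2) c :: x.2).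
(* [l0] holds the fixed point of [n |-> Q n + J] when it lies in [Z]: it may be its own preimage
   forever and never reach [X']. *)
have [l0 [l0r l0P]] : exists l0 : seq (int * seq int),
   (forall x, x \in l0 -> [/\ x.2 = [::], Z x.1 & (Q%:Z - 1) * x.1 + J = 0]) /\
   forall n, Z n -> (Q%:Z - 1) * n + J = 0 -> (n, [::]) \in l0.
  have [[n0 [Zn0 n0P]]|nofix] := classic (exists n, Z n /\ (Q%:Z - 1) * n + J = 0).
    exists [:: (n0, [::])]; split=> [x|n Zn nP]; first by rewrite inE => /eqP->.
    rewrite inE; apply/eqP; congr (_, _).
    have Q1 : Q%:Z - 1 != 0.
      have : (1 < Q)%N by rewrite /Q -(exp1n (e * a)) ltn_exp2r // muln_gt0 e0.
      by clear; move: Q => Q; lia.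
    by apply: (mulfI Q1); apply: (addIr J); rewrite nP n0P.
  by exists [::]; split=> // n Zn nP; case: nofix; exists n.
have ea0 : (0 < e * a)%N by rewrite muln_gt0 e0.
have Q_gt1 : (1 < Q)%N by rewrite /Q -(exp1n (e * a)) ltn_exp2r.
exists (e * a)%N => //; rewrite -/Q; exists (map g l ++ l0); split=> [x|n].
  by rewrite mem_cat => /orP[/mapP[y /lr yr ->]|/l0r[->]].
split=> [Zn|[x]].
  (* The similarity multiplies [(Q - 1) n + J] by [Q], so this quantity, when nonzero, decreases in
     absolute value as a step is undone. *)
  have [m] := ubnP (absz ((Q%:Z - 1) * n + J)%R); elim: m n Zn => // m IH n Zn ltm.
  have [n0|n0] := eqVneq ((Q%:Z - 1) * n + J) 0.
    by exists (n, [::]); rewrite // mem_cat l0P // orbT.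
  case: ((ZEs a n).1 Zn) => [X'n|[n' Zn' nE]].
    have [x xl xP] := (lP n).1 X'n.
    exists (g x); first by rewrite mem_cat map_f.
    by exists 0%N; rewrite geo0 mulr0 addr0.
  have nE' : n = Q%:Z * n' + J by rewrite nE -QE -/J addrC.
  have yE : (Q%:Z - 1) * n + J = Q%:Z * ((Q%:Z - 1) * n' + J) by rewrite nE'; ring.
  have ltn' : (absz ((Q%:Z - 1) * n' + J)%R < absz ((Q%:Z - 1) * n + J)%R)%N.
    rewrite yE abszM absz_nat -{1}[absz (_ + J)%R]mul1n ltn_pmul2r // lt0n absz_eq0.
    by apply: contraNneq n0 => y0; rewrite yE y0 mulr0.
  have [|x] := IH n' Zn'; first by rewrite -ltnS; apply: leq_trans ltm; rewrite ltnS.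
  rewrite mem_cat => /orP[/mapP[y yl ->] n'P|xl0]; last first.
    have [x2 _ x1] := l0r _ xl0; rewrite x2 /= => n'x.
    by move: n0; rewrite yE n'x x1 mulr0 eqxx.
  exists (g y); first by rewrite mem_cat map_f.
  have := geo_points_frob J n'P; rewrite -nE' /g /= big_cons => nP.
  by move: nP; rewrite (_ : _ - _ + J = y.1) //; ring.
rewrite mem_cat => /orP[/mapP[y yl ->] /= [k nP]|xl0]; last first.
  by have [x2 Zx _] := l0r _ xl0; rewrite x2 => ->.
apply: (geo_points_closed (l := k) ea0 Zcl _ nP) => {n nP} m; rewrite -/Q.
set c := _ - _; elim: k m => [|k IH] m.
  rewrite geo0 mulr0 addr0 => /geo_points_ge0 mP.
  by apply/X'Z/lP; exists y.
rewrite geoS => mP.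
have [|m' [m'P ->]] := @geo_points_ge_frob_inv Q k J (y.1 + c * (geo Q k)%:Z) y.2 m.
  by move: mP; congr geo_points_ge; rewrite PoszD PoszM /c; ring.
by apply: ZQ; apply: IH.
Qed.

(** * Powers of a vector in a subspace *)

Lemma exists_maxn (P : nat -> Prop) b : (exists n, P n) -> (forall n, P n -> (n <= b)%N) ->
  exists n, P n /\ forall m, P m -> (m <= n)%N.
Proof.
move=> [n0 Pn0] Pb.
have [k [[n [Pn kE]] kmin]] : exists k, (exists n, P n /\ k = (b - n)%N) /\
    forall m, (exists n, P n /\ m = (b - n)%N) -> (k <= m)%N.
  by apply: exists_minn; exists (b - n0)%N, n0.
exists n; split=> // m Pm; have := kmin (b - m)%N; rewrite kE.
by have := Pb _ Pn; have := Pb _ Pm => mb nb /(_ (ex_intro _ m (conj Pm erefl))); lia.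
Qed.

Section Descent.
Variables (L : fieldType) (p : nat) (t : nat) (beta : 'I_t -> L).
Hypothesis hp : p \in [pchar L].
Hypothesis L_fin : height_finite p L.
Hypothesis beta0 : forall b, beta b != 0.
Hypothesis beta_ntors : forall a b n, a != b -> (0 < n)%N -> beta a ^+ n != beta b ^+ n.

Let p_prime : prime p := pcharf_prime hp.
Let p_gt0 : (0 < p)%N := prime_gt0 p_prime.
Let pX_gt0 k : (0 < p ^ k)%N. Proof. by rewrite expn_gt0 p_gt0. Qed.

(** Built as a ring morphism, so that [map_mx] preserves ranks and inclusions. *)
Fixpoint frob k : {rmorphism L -> L} :=
  if k is k'.+1 then (pFrobenius_aut hp \o frob k' : {rmorphism L -> L})
  else (idfun : {rmorphism L -> L}).

Lemma frobE k x : frob k x = x ^+ (p ^ k).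
Proof.
elim: k => [|k IH] /=; first by rewrite expn0 expr1.
by rewrite IH pFrobenius_autE -exprM expnSr.
Qed.

Lemma frob_inj k (x y : L) : x ^+ (p ^ k) = y ^+ (p ^ k) -> x = y.
Proof. by rewrite -!frobE => /fmorph_inj. Qed.

Definition pow_row (n : int) : 'rV[L]_t := \row_b beta b ^ n.

Lemma diag_pow_unit n : diag_mx (pow_row n) \in unitmx.
Proof.
rewrite unitmxE det_diag unitfE; apply/prodf_neq0 => b _.
by rewrite mxE expfz_neq0.
Qed.

Lemma pow_row_frob k (m n : int) :
  pow_row (m + (p ^ k)%N%:Z * n) = map_mx (frob k) (pow_row n) *m diag_mx (pow_row m).
Proof.
apply/rowP => b; rewrite mul_mx_diag !mxE frobE expfzDr // mulrC; congr (_ * _).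
by rewrite mulrC -exprz_exp exprnP.
Qed.

Lemma rank_frob_diag m (U : 'M[L]_(m, t)) k n :
  \rank (map_mx (frob k) U *m diag_mx (pow_row n)) = \rank U.
Proof. by rewrite mxrankMfree ?mxrank_map // row_free_unit diag_pow_unit. Qed.

(** Frobenius is semilinear, so the vectors sent into [W] form a subspace. As [L] may be imperfect,
    inverse Frobenius cannot be applied to the entries of [W]; a solution of maximal rank is taken
    instead. *)
Lemma pullback m (W : 'M[L]_(m, t)) k n : exists U : 'M[L]_t,
  (map_mx (frob k) U *m diag_mx (pow_row n) <= W)%MS /\
  forall v : 'rV[L]_t, (map_mx (frob k) v *m diag_mx (pow_row n) <= W)%MS -> (v <= U)%MS.
Proof.
pose P r := exists U : 'M[L]_t,
  (map_mx (frob k) U *m diag_mx (pow_row n) <= W)%MS /\ \rank U = r.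
have [||_ [[U [UW <-]] Umax]] := @exists_maxn P t.
- by exists 0%N, 0; rewrite map_mx0 mul0mx sub0mx mxrank0.
- by move=> _ [U [_ <-]]; apply: rank_leq_row.
exists U; split=> // v vW.
have /Umax le : P (\rank (U + v)%MS).
  exists (U + v)%MS; split=> //.
  by rewrite (eqmxMr _ (map_addsmx _ _ _)) addsmxMr addsmx_sub UW vW.
have := mxrank_leqif_sup (addsmxSl U v); rewrite /leqif eqn_leq le andbT.
by case=> leU; rewrite leU => /esym /(submx_trans (addsmxSr U v)).
Qed.

Definition hits m (W : 'M[L]_(m, t)) (n : int) : Prop := (pow_row n <= W)%MS.

Lemma hits_frob m m' (W : 'M[L]_(m, t)) (U : 'M[L]_(m', t)) k (i n : int) :
  (W :=: map_mx (frob k) U *m diag_mx (pow_row i))%MS ->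
  hits W (i + (p ^ k)%N%:Z * n) <-> hits U n.
Proof.
move=> WU; rewrite /hits WU pow_row_frob.
rewrite submxMfree ?map_submx // row_free_unit; exact: diag_pow_unit.
Qed.

(** * Linear dependence along exponential sequences *)

Section GeoClosed.
Variables (e : nat) (c : int).
Let q := (p ^ e)%N.
Let w k := pow_row (c * (geo q k)%:Z).
Let S M k : 'M[L]_(M, t) := \matrix_(i < M) w (k + i).

Let wS k : w k.+1 = map_mx (frob e) (w k) *m diag_mx (pow_row c).
Proof. by rewrite /w -pow_row_frob geoS; congr pow_row; rewrite PoszD PoszM -/q; ring. Qed.

Let SS M k : S M k.+1 = map_mx (frob e) (S M k) *m diag_mx (pow_row c).
Proof. by apply/row_matrixP => i; rewrite row_mul -map_row !rowK addSn wS. Qed.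

Let Scons M k : S M.+1 k = col_mx (w k) (S M k.+1) :> 'M_(1 + M, t).
Proof.
apply/matrixP => i b; rewrite [RHS]mxE [LHS]mxE; case: splitP => j ij.
  by rewrite ij [j]ord1 addn0.
by rewrite [RHS]mxE ij /= addnA addn1.
Qed.

(* With [M] minimal such that [w_0, ..., w_M] are dependent, [w_0] must occur in
   the dependency, as the Frobenius twist relating [w_k] to [w_k.+1] preserves
   independence. *)
Let w_span : exists M, forall k, (w k <= S M k.+1)%MS.
Proof.
have [M [Mdep Mmin]] : exists M, ~~ row_free (S M 0) /\
    forall m, ~~ row_free (S m 0) -> (M <= m)%N.
  apply: exists_minn; exists t.+1; rewrite /row_free neq_ltn ltnS.
  by rewrite rank_leq_col.
case: M Mdep Mmin => [|M] Mdep Mmin.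
  by case/negP: Mdep; rewrite /row_free mxrank_eq0 flatmx0.
have Mfree : row_free (S M 0) by apply/negPn/negP => /Mmin; rewrite ltnn.
have Mfree1 : row_free (S M 1) by rewrite /row_free SS rank_frob_diag.
exists M; elim=> [|k IH]; last first.
  by rewrite wS SS; apply: submxMr; rewrite map_submx.
move: Mdep; rewrite -kermx_eq0 => /rowV0Pn[u /sub_kermxP uS u0].
pose a := lsubmx (u : 'rV_(1 + M)); pose v := rsubmx (u : 'rV_(1 + M)).
have uE : u = row_mx a v :> 'rV_(1 + M) by rewrite hsubmxK.
have {}uS : a *m w 0%N + v *m S M 1 = 0 by rewrite -mul_row_col -Scons -uE.
have [a0|a0] := eqVneq (a 0 0) 0.
  have aE : a = 0 by apply/rowP => i; rewrite ord1 a0 mxE.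
  move: uS; rewrite aE mul0mx add0r => vS.
  have v0 : v = 0 by apply: (row_free_inj Mfree1); rewrite vS mul0mx.
  by move: u0; rewrite uE aE v0 row_mx0 eqxx.
have -> : w 0%N = (a 0 0)^-1 *: (- v *m S M 1).
  move: uS; rewrite [X in X *m w 0%N]mx11_scalar mul_scalar_mx => /eqP.
  by rewrite addr_eq0 mulNmx => /eqP<-; rewrite scalerA mulVf ?scale1r.
by apply/scalemx_sub/submxMl.
Qed.

(** By [w_span] the vector at exponent [k0] is a combination of vectors at later exponents, so the
    threshold can be lowered one step at a time. *)
Lemma hits_geo_closed m (W : 'M[L]_(m, t)) C k0 :
  (forall k, (k0 <= k)%N -> hits W (C + c * (geo q k)%:Z)) ->
  forall k, hits W (C + c * (geo q k)%:Z).
Proof.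
have [M wM] := w_span.
have wC k : pow_row (C + c * (geo q k)%:Z) = w k *m diag_mx (pow_row C).
  by apply/rowP => b; rewrite mul_mx_diag !mxE expfzDr // mulrC.
elim: k0 => [|k0 IH] WP; first by move=> k; apply: WP.
apply: IH => k; rewrite leq_eqVlt => /orP[/eqP<-|]; last exact: WP.
rewrite /hits wC; apply: submx_trans (submxMr _ (wM k0)) _.
by apply/row_subP => i; rewrite row_mul rowK -wC; apply: WP; rewrite leq_addr.
Qed.

End GeoClosed.

(** [s] bounds the depth of iterated [p]-th roots of [rho]: [L_fin] leaves finitely many such roots,
    and each has a single depth since [rho] is not a root of unity. If [p ^ (k - s)] did not divide
    [n], cancelling the [p]-part of [n] and applying Bezout would produce a root of [rho] deeper
    than [s]. *)
Lemma perfect_depth (rho : L) : rho != 0 -> (forall n, (0 < n)%N -> rho ^+ n != 1) ->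
  exists s, forall k (n : int) (y : L), rho ^ n = y ^+ (p ^ k) ->
    ((p ^ (k - s))%N%:Z %| n)%Z.
Proof.
move=> rho0 rho_ntors.
pose P k := exists x : L, x ^+ (p ^ k) = rho.
have [s sP] : exists s, forall k, P k -> (k <= s)%N.
  suff [l lP] : finite_pred P by exists (\max_(k <- l) k) => k /lP kl; apply: leq_bigmax_seq.
  have fin_x : finite_pred (fun x : L => exists k, x ^+ (p ^ k) = rho).
    apply: finite_sub (L_fin [:: rho] 1) => x [k xk]; exists k; rewrite xk mul1n.
    apply: (@bounded_degW _ _ 1) => //.
    by have := bounded_degM (mem_head rho [::]) (bounded_deg1 [:: rho] 0); rewrite mulr1.
  apply: finite_sub (finite_bigcup (Q := fun (x : L) k => x ^+ (p ^ k) = rho) fin_x _).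
    by move=> k [x xk]; exists x => //; exists k.
  move=> x _; have [[k0 k0P]|] := classic (exists k, x ^+ (p ^ k) = rho); last first.
    by move=> nk; exists [::] => k kP; case: nk; exists k.
  have noj k j : x ^+ (p ^ k) = rho -> x ^+ (p ^ (k + j.+1)) = rho -> False.
    move=> kP; rewrite expnD exprM kP => jP.
    have ltp : (0 < p ^ j.+1 - 1)%N.
      by rewrite subn_gt0 -(exp1n j.+1) ltn_exp2r // prime_gt1.
    have := rho_ntors _ ltp; move/eqP; apply; apply: (mulIf rho0).
    by rewrite -exprSr subn1 prednK // mul1r.
  exists [:: k0] => k kP; rewrite inE; case: (ltngtP k k0) => // lt; exfalso.
    by apply: (noj k (k0 - k).-1) => //; rewrite prednK ?subn_gt0 // subnKC // ltnW.
  by apply: (noj k0 (k - k0).-1) => //; rewrite prednK ?subn_gt0 // subnKC // ltnW.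
exists s => k n y ny; have [->|n0] := eqVneq n 0; first by rewrite dvdz0.
have n0' : (0 < absz n)%N by rewrite lt0n absz_eq0.
rewrite dvdzE absz_nat pfactor_dvdn //; rewrite leqNgt; apply/negP => ltv.
set v := logn p (absz n) in ltv.
have [n' n'E] : exists n', n = n' * (p ^ v)%N%:Z.
  by apply/dvdzP; rewrite dvdzE absz_nat pfactor_dvdnn.
have co : coprimez n' (p ^ (k - v))%N%:Z.
  rewrite coprimezE absz_nat coprime_sym coprimeXl //; rewrite prime_coprime //.
  apply/negP => pn'; have : (p ^ v.+1 %| absz n)%N.
    by rewrite n'E abszM absz_nat expnS dvdn_mul.
  by rewrite pfactor_dvdn // ltnn.
have y' : rho ^ n' = y ^+ (p ^ (k - v)).
  apply: (@frob_inj v); rewrite -exprM -expnD subnK; last by lia.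
  by rewrite -ny n'E -exprz_exp exprnP.
have /coprimezP[[u w] /= uw] := co.
suff /sP : P (k - v)%N by lia.
exists (y ^ u * rho ^ w); rewrite exprMn.
have -> : (y ^ u) ^+ (p ^ (k - v)) = rho ^ (u * n').
  by rewrite mulrC -exprz_exp y' !exprnP !exprz_exp mulrC.
by rewrite exprnP exprz_exp -expfzDr // uw expr1z.
Qed.

(** * Echelon forms with pivot columns [f] and their descendants *)

Section NormalForm.
Variables (r : nat) (f : 'I_r -> 'I_t).

Let rho i b := beta b / beta (f i).

Let rho0 i b : rho i b != 0.
Proof. by rewrite mulf_neq0 ?invr_eq0. Qed.

Let rho_ntors i b n : b != f i -> (0 < n)%N -> rho i b ^+ n != 1.
Proof.
move=> bfi n0; rewrite exprMn exprVn; apply/negP => /eqP E.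
have /eqP := beta_ntors bfi n0; apply.
by rewrite -[LHS](divfK (expf_neq0 n (beta0 (f i)))) E mul1r.
Qed.

(** Dividing by [beta (f i)] is what keeps the pivot entries equal to 1. *)
Definition frob_rel k (m : int) (A A' : 'M[L]_(r, t)) :=
  forall i b, A i b = (beta b / beta (f i)) ^ m * A' i b ^+ (p ^ k).

Lemma frob_rel_trans k k' (m m' : int) A A' A'' :
  frob_rel k m A A' -> frob_rel k' m' A' A'' ->
  frob_rel (k + k') (m + (p ^ k)%N%:Z * m') A A''.
Proof.
move=> AA' A'A'' i b; rewrite AA' A'A'' -/(rho i b) exprMn expfzDr // mulrA.
by rewrite -exprM -expnD addnC exprnP exprz_exp [m' * _]mulrC.
Qed.

Lemma frob_rel_split k k' (m m' : int) A A'' :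
  frob_rel (k + k') (m + (p ^ k)%N%:Z * m') A A'' ->
  exists A', frob_rel k m A A' /\ frob_rel k' m' A' A''.
Proof.
move=> AA''.
exists (\matrix_(i, b) ((beta b / beta (f i)) ^ m' * A'' i b ^+ (p ^ k'))).
split=> i b; last by rewrite mxE.
rewrite mxE AA'' -/(rho i b) exprMn expfzDr // mulrA.
by rewrite -exprM -expnD addnC [X in _ = _ * X * _]exprnP exprz_exp [m' * _]mulrC.
Qed.

(** The part of the exponent divisible by [p ^ k] contributes a [p ^ k]-th power, which is absorbed
    into the descendant. *)
Lemma frob_rel_mod k (m : int) A A' : frob_rel k m A A' ->
  exists A'', frob_rel k (m %% (p ^ k)%N%:Z)%Z A A'' /\
    frob_rel 0 (m %/ (p ^ k)%N%:Z)%Z A'' A'.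
Proof.
move=> AA'; apply: frob_rel_split; rewrite addn0 addrC mulrC.
by rewrite -divz_eq.
Qed.

Lemma frob_rel_nf k m A A' : frob_rel k m A A' -> colsub f A = 1%:M -> colsub f A' = 1%:M.
Proof.
move=> AA' nfA; apply/matrixP => i j; rewrite !mxE.
have := congr1 (fun B : 'M_r => B i j) nfA; rewrite !mxE AA' => Aij.
have [ij|ij] := eqVneq i j; rewrite ?(negPf ij) /= in Aij *.
  move: Aij; rewrite ij eqxx divff // exp1rz mul1r => Aij.
  by apply: (@frob_inj k); rewrite Aij expr1n.
move/eqP: Aij; rewrite mulf_eq0 (negPf (expfz_neq0 _ (rho0 i (f j)))) /=.
by rewrite expf_eq0 pX_gt0 => /eqP.
Qed.

Lemma frob_rel_mx k m A A' : frob_rel k m A A' ->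
  A = diag_mx (\row_i beta (f i) ^ (- m)) *m (map_mx (frob k) A' *m diag_mx (pow_row m)).
Proof.
move=> AA'; apply/matrixP => i b; rewrite AA' mul_diag_mx mul_mx_diag !mxE frobE.
by rewrite expfzMl -exprz_inv; ring.
Qed.

Lemma frob_rel_eqmx k m A A' : frob_rel k m A A' ->
  (A :=: map_mx (frob k) A' *m diag_mx (pow_row m))%MS.
Proof.
move=> /frob_rel_mx {1}->; apply: eqmxMfull; rewrite row_full_unit unitmxE det_diag.
by rewrite unitfE; apply/prodf_neq0 => i _; rewrite mxE expfz_neq0.
Qed.

Lemma nf_rank (A : 'M[L]_(r, t)) : colsub f A = 1%:M -> \rank A = r.
Proof.
move=> nfA; apply/eqP; rewrite eqn_leq rank_leq_row /=.
have rA : \rank (colsub f A) = r by rewrite nfA mxrank1.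
by apply: leq_trans (eq_leq (esym rA)) _; rewrite -{1}[A]mulmx1 -mulmx_colsub mxrankM_maxl.
Qed.

Lemma nf_of_unit (B : 'M[L]_(r, t)) : colsub f B \in unitmx ->
  exists A : 'M[L]_(r, t), colsub f A = 1%:M /\ (A :=: B)%MS.
Proof.
move=> Bu; exists (invmx (colsub f B) *m B); rewrite -mulmx_colsub mulVmx //.
by split=> //; apply: eqmxMfull; rewrite row_full_unit unitmx_inv.
Qed.

(* The pullback of the row space of [A] has dimension at most [r]; when the
   dimension is [r], its echelon form is related to [A] entry by entry. *)
Lemma frob_rel_or_drop k (m : int) (A : 'M[L]_(r, t)) : colsub f A = 1%:M ->
  (exists A', frob_rel k m A A') \/
  exists U : 'M[L]_t, (\rank U < r)%N /\
    forall n, hits A (m + (p ^ k)%N%:Z * n) <-> hits U n.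
Proof.
move=> nfA; have [U [UA Umax]] := pullback A k m.
have rA := nf_rank nfA.
have leUr : (\rank U <= r)%N by rewrite -(rank_frob_diag U k m) -rA mxrankS.
have [ltUr|] := ltnP (\rank U) r.
  right; exists U; split=> // n; rewrite /hits pow_row_frob.
  split=> [/Umax //|nU]; apply: submx_trans UA.
  by apply: submxMr; rewrite map_submx.
move=> gerU; have {gerU leUr} rU : \rank U = r by apply/eqP; rewrite eqn_leq leUr.
left; have [U0 U0U] : exists U0 : 'M[L]_(r, t), (U0 :=: U)%MS.
  by rewrite -rU; exists (row_base U); apply: eq_row_base.
have fU0A : (map_mx (frob k) U0 *m diag_mx (pow_row m) <= A)%MS.
  by apply: submx_trans UA; apply: submxMr; rewrite map_submx U0U.
have AfU0 : (A <= map_mx (frob k) U0 *m diag_mx (pow_row m))%MS.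
  by have [_ <-] := mxrank_leqif_sup fU0A; rewrite rank_frob_diag U0U rU rA.
have colD (V : 'M[L]_(r, t)) : colsub f (map_mx (frob k) V *m diag_mx (pow_row m)) =
    map_mx (frob k) (colsub f V) *m diag_mx (\row_i beta (f i) ^ m).
  by apply/matrixP => i j; rewrite mul_mx_diag mxE mul_mx_diag !mxE.
(* The pivot columns of [A] are the identity and factor through those of [U0], up to Frobenius and a
   diagonal matrix, so the latter are invertible. *)
have [A' [nfA' A'U0]] : exists A' : 'M[L]_(r, t), colsub f A' = 1%:M /\ (A' :=: U0)%MS.
  apply: nf_of_unit; case/submxP: AfU0 => Q AQ.
  have := congr1 (colsub f) AQ; rewrite nfA -mulmx_colsub colD => /esym.
  by case/mulmx1_unit=> _; rewrite unitmx_mul map_unitmx => /andP[].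
exists A' => i b; have {}AfU0 : (A <= map_mx (frob k) A' *m diag_mx (pow_row m))%MS.
  by apply: submx_trans AfU0 _; apply: submxMr; rewrite map_submx A'U0.
case/submxP: AfU0 => Q AQ.
have := congr1 (colsub f) AQ; rewrite nfA -mulmx_colsub colD nfA' map_mx1 mul1mx.
rewrite mul_mx_diag => QE.
(* On the pivot columns [A] and [A'] are both the identity, which forces [Q] to be diagonal and to
   invert the twist there. *)
have Qij j : Q i j = (i == j)%:R * beta (f i) ^ (- m).
  have := congr1 (fun B : 'M_r => B i j) QE; rewrite !mxE; case: eqP => [->|_] E.
    by rewrite E -mulrA -expfzDr // subrr expr0z mulr1.
  move/esym/eqP: E; rewrite mulf_eq0 (negPf (expfz_neq0 _ (beta0 _))) orbF.
  by move/eqP->; rewrite mul0r.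
rewrite [in LHS]AQ mxE (bigD1 i) //= big1 ?addr0 => [|j ji]; last first.
  by rewrite Qij eq_sym (negPf ji) !mul0r.
rewrite Qij eqxx mul1r mul_mx_diag !mxE frobE expfzMl -exprz_inv; ring.
Qed.

(** As [m < p ^ k], the [p ^ k]-th power of an entry of [A'] has degree at most [m.+1 <= p ^ k] in
    [A i b] and the inverse of [rho i b]: this is the finiteness property with [l = 1]. *)
Lemma frob_desc_finite A : finite_pred (fun A' => exists k (m : nat),
  (m < p ^ k)%N /\ frob_rel k m A A').
Proof.
pose P i b (x : L) := exists k (m : nat), (m < p ^ k)%N /\
  A i b = rho i b ^ m * x ^+ (p ^ k).
apply: finite_sub (finite_matrices (P := P) _) => [A' [k [m [ltm AA']]] i b|i b].
  by exists k, m; split=> //; apply: AA'.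
apply: finite_sub (L_fin [:: A i b; (rho i b)^-1] 1) => x [k [m [ltm xE]]]; exists k.
have -> : x ^+ (p ^ k) = A i b * (rho i b)^-1 ^+ m.
  by rewrite xE -exprnP mulrAC -exprMn divff // expr1n mul1r.
rewrite mul1n; apply: (@bounded_degW _ _ m.+1) => //.
apply: bounded_degM; first by rewrite mem_head.
set S := [:: _; _].
have bS : bounded_deg S 1 (rho i b)^-1.
  rewrite -[_^-1]mulr1; apply: bounded_degM; last exact: bounded_deg1.
  by rewrite !inE eqxx orbT.
by have := bounded_degX m bS; rewrite muln1.
Qed.

Definition exhausted A := exists k, forall (m : int) A', ~ frob_rel k m A A'.

Lemma not_exhausted A : ~ exhausted A -> forall k, exists (m : int) A', frob_rel k m A A'.
Proof.
move=> nA k; apply: NNPP => nk; apply: nA; exists k => m A' AA'; apply: nk.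
by exists m, A'.
Qed.

(** Pigeonhole: one digit string of length [K = size s] passes through [K + 1] descendants, all of
    them in [s], so two coincide. *)
Lemma periodic_descendant A : ~ exhausted A ->
  exists k (m : nat) U e (j : nat),
    [/\ (m < p ^ k)%N, frob_rel k m A U, (0 < e)%N, (j < p ^ e)%N & frob_rel e j U U].
Proof.
move=> /not_exhausted nA; have [s sP] := frob_desc_finite A.
have [m0 [A0 /frob_rel_mod[A1 [AA1 _]]]] := nA (size s).
set K := size s in AA1 *; set m := (m0 %% _)%Z in AA1.
have m_ge0 : (0 <= m)%R by rewrite modz_ge0 // eqz_nat -lt0n.
have mlt : (m < (p ^ K)%N%:Z)%R by rewrite ltz_pmod // ltz_nat.
case: m m_ge0 mlt AA1 => // m _ mlt AA1.
(* [B i] is the descendant of [A] along the lowest [i] base-[p] digits of [m]. *)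
pose B i : 'M[L]_(r, t) :=
  \matrix_(a, b) (rho a b ^+ (m %/ p ^ i) * A1 a b ^+ (p ^ (K - i))).
have BB i i' : (i <= i')%N -> (i' <= K)%N ->
    frob_rel (i' - i) ((m %/ p ^ i) %% p ^ (i' - i))%N (B i) (B i').
  move=> ii' i'K a b; rewrite !mxE -/(rho a b) -exprnP.
    rewrite [(_ * _ ^+ (p ^ (K - i'))) ^+ _]exprMn mulrA -!exprM -exprD.
  have -> : ((m %/ p ^ i) %% p ^ (i' - i) + m %/ p ^ i' * p ^ (i' - i) = m %/ p ^ i)%N.
    by rewrite [in RHS](divn_eq (m %/ p ^ i) (p ^ (i' - i))) -divnMA -expnD subnKC // addnC.
  by rewrite -expnD; congr (_ * _ ^+ (_ ^ _)%N); lia.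
have B0 : B 0%N = A.
  by apply/matrixP => a b; rewrite !mxE AA1 -exprnP expn0 divn1 subn0.
have Bs i : (i <= K)%N -> B i \in s.
  move=> iK; apply: sP; exists i, (m %% p ^ i)%N; split; first by rewrite ltn_mod.
  by have := BB 0%N i (leq0n _) iK; rewrite B0 subn0 expn0 divn1.
have /(uniqPn 0)[i [i' [lti]]] : ~~ uniq [seq B i | i <- iota 0 K.+1].
  apply/negP => Bu; suff /(uniq_leq_size Bu) : {subset [seq B i | i <- iota 0 K.+1] <= s}.
    by rewrite size_map size_iota ltnn.
  by move=> _ /mapP[i iI ->]; apply: Bs; move: iI; rewrite mem_iota add0n ltnS.
rewrite size_map size_iota => lti'.
rewrite !(nth_map 0%N) ?size_iota //; last exact: ltn_trans lti lti'.
rewrite !nth_iota //; last exact: ltn_trans lti lti'.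
rewrite !add0n => BE.
exists i, (m %% p ^ i)%N, (B i), (i' - i)%N, ((m %/ p ^ i) %% p ^ (i' - i))%N.
split; rewrite ?ltn_mod ?subn_gt0 //.
  have := BB 0%N i (leq0n _); rewrite B0 subn0 expn0 divn1; apply.
  by rewrite -ltnS; apply: ltn_trans lti lti'.
by rewrite [X in frob_rel _ _ _ X]BE; apply: BB => //; apply: ltnW.
Qed.
(** Both descents can be continued [s] steps further. The quotient of the two expressions for
    [A i b] makes a power of [rho i b] a [p ^ (k + s)]-th power, so [perfect_depth] gives the
    congruence of [m] and [m'] modulo [p ^ k]. The column [b] must not be the pivot [f i], where the
    ratio is 1. *)
Lemma exhausted_unique (A A1 A2 : 'M[L]_(r, t)) i b k (m m' : nat) :
  b != f i -> A i b != 0 -> (m < p ^ k)%N -> (m' < p ^ k)%N ->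
  frob_rel k m A A1 -> frob_rel k m' A A2 ->
  ~ exhausted A1 -> ~ exhausted A2 -> m = m'.
Proof.
move=> bfi Aib ltm ltm' AA1 AA2 /not_exhausted nA1 /not_exhausted nA2.
have [s sP] := perfect_depth (rho0 i b) (fun n n0 => rho_ntors bfi n0).
have [m1 [A1' /(frob_rel_trans AA1) AA1']] := nA1 s.
have [m2 [A2' /(frob_rel_trans AA2) AA2']] := nA2 s.
have := AA1' i b; have := AA2' i b; rewrite -/(rho i b).
set n1 := _ + _ * m1; set n2 := _ + _ * m2.
set x := A1' i b; set y := A2' i b => E2 E1.
have y0 : y ^+ (p ^ (k + s)) != 0.
  by apply: contraNneq Aib => y0; rewrite E2 y0 mulr0.
have E : rho i b ^ (n2 - n1) = (x / y) ^+ (p ^ (k + s)).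
  apply: (mulIf (expfz_neq0 n1 (rho0 i b))); rewrite -expfzDr // subrK.
  rewrite exprMn exprVn; apply: (mulIf y0); rewrite -E2 E1.
  by rewrite [RHS]mulrAC mulfVK // mulrC.
have := sP _ _ _ E; rewrite addnK => dvd.
have : ((p ^ k)%N%:Z %| (m'%:Z - m%:Z))%Z.
  have -> : m'%:Z - m%:Z = (n2 - n1) - (p ^ k)%N%:Z * (m2 - m1) by rewrite /n1 /n2; ring.
  by apply: rpredB => //; apply: dvdz_mulr; apply: dvdzz.
rewrite -eqz_mod_dvd => /eqP; rewrite !modz_nat => -[].
by rewrite !modn_small.
Qed.

Lemma int_slice k (n : int) : exists (m : nat) (n' : int),
  (m < p ^ k)%N /\ n = m%:Z + (p ^ k)%N%:Z * n'.
Proof.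
have q0 : (p ^ k)%N%:Z != 0 by rewrite eqz_nat -lt0n.
exists (absz (n %% (p ^ k)%N%:Z)%Z), (n %/ (p ^ k)%N%:Z)%Z.
rewrite -ltz_nat gez0_abs ?modz_ge0 // ltz_pmod ?ltz_nat //; split=> //.
by rewrite [LHS](divz_eq n (p ^ k)%N%:Z) addrC mulrC.
Qed.

Lemma nested_slices r0 k (s : seq nat) (Z : int -> Prop) :
  (forall m, m \in s -> nested p r0 (fun n => Z (m%:Z + (p ^ k)%N%:Z * n))) ->
  nested p r0 (fun n => exists2 m, m \in s &
    exists2 n', Z (m%:Z + (p ^ k)%N%:Z * n') & n = m%:Z + (p ^ k)%N%:Z * n').
Proof. by move=> sZ; apply: nested_bigcup => m /sZ; apply: nested_affine. Qed.

Lemma slicesE k (Z : int -> Prop) n : Z n <-> exists2 m, m \in iota 0 (p ^ k) &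
  exists2 n', Z (m%:Z + (p ^ k)%N%:Z * n') & n = m%:Z + (p ^ k)%N%:Z * n'.
Proof.
split=> [Zn|[m _ [n' Zn' ->]] //].
have [m [n' [ltm nE]]] := int_slice k n; exists m; first by rewrite mem_iota.
by exists n'; rewrite // -nE.
Qed.

Section Induction.
Hypothesis IHr : forall U : 'M[L]_t, (\rank U < r)%N -> nested p r.-1 (hits U).

Lemma exhausted_nested (A : 'M[L]_(r, t)) :
  colsub f A = 1%:M -> exhausted A -> nested p r.-1 (hits A).
Proof.
move=> nfA [k kP]; apply: nested_ext (fun n => iff_sym (slicesE k (hits A) n)) _.
apply: nested_slices => m _; case: (frob_rel_or_drop k m nfA) => [[A' /kP[]]|[U [/IHr UN UE]]].
by apply: nested_ext UN => n; rewrite UE.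
Qed.

(** Only [m] leads to a descendant that is not exhausted; the string [m'] either drops the dimension
    or leads to an exhausted matrix, and both cases reduce to lower dimension. *)
Lemma slice_nested (A U : 'M[L]_(r, t)) i b k (m m' : nat) :
  colsub f A = 1%:M -> b != f i -> A i b != 0 -> (m < p ^ k)%N -> (m' < p ^ k)%N ->
  m' != m -> frob_rel k m A U -> ~ exhausted U ->
  nested p r.-1 (fun n => hits A (m'%:Z + (p ^ k)%N%:Z * n)).
Proof.
move=> nfA bfi Aib ltm ltm' mm' AU nU.
case: (frob_rel_or_drop k m' nfA) => [[A' AA']|[V [/IHr VN VE]]]; last first.
  by apply: nested_ext VN => n; rewrite VE.
have eA' : exhausted A'.
  apply: NNPP => nA'; case/eqP: mm'.
  exact: (exhausted_unique bfi Aib ltm' ltm AA' AU).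
have := exhausted_nested (frob_rel_nf AA' nfA) eA'; apply: nested_ext => n.
by apply: iff_sym; apply: hits_frob; apply: frob_rel_eqmx.
Qed.

Lemma periodic_not_exhausted (U : 'M[L]_(r, t)) e (j : nat) :
  (0 < e)%N -> frob_rel e j U U -> ~ exhausted U.
Proof.
move=> e0 UU [k kP]; have [J UJ] : exists J, frob_rel (e * k) J U U.
  elim: k {kP} => [|k [J UJ]]; last first.
    by exists (j%:Z + (p ^ e)%N%:Z * J); rewrite mulnS; apply: frob_rel_trans.
  by exists 0 => i b; rewrite expr0z mul1r muln0 expr1.
have le : (k <= e * k)%N by rewrite leq_pmull.
have [U' [UU' _]] : exists U', frob_rel k J U U' /\ frob_rel (e * k - k) 0 U' U.
  by apply: frob_rel_split; rewrite subnKC // mulr0 addr0.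
exact: kP UU'.
Qed.

(** The slice at [j] is a copy of [hits U] itself and all others come from lower dimension, which is
    the equation solved by [nested_selfsimilar]. *)
Lemma periodic_nested (U : 'M[L]_(r, t)) i b e (j : nat) :
  colsub f U = 1%:M -> b != f i -> U i b != 0 -> (0 < e)%N -> (j < p ^ e)%N ->
  frob_rel e j U U -> nested p r (hits U).
Proof.
move=> nfU bfi Uib e0 ltj UU; have nU := periodic_not_exhausted e0 UU.
have r0 : (0 < r)%N by rewrite (leq_ltn_trans _ (ltn_ord i)).
apply: (@nestedW p r.-1.+1); first by rewrite prednK.
pose s := [seq m <- iota 0 (p ^ e) | m != j].
have XN : nested p r.-1 (fun n => exists2 m, m \in s &
    exists2 n', hits U (m%:Z + (p ^ e)%N%:Z * n') & n = m%:Z + (p ^ e)%N%:Z * n').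
  apply: nested_slices => m; rewrite mem_filter mem_iota add0n => /andP[mj ltm].
  exact: (slice_nested nfU bfi Uib ltj ltm mj UU nU).
have Ucl : geo_closed p (hits U) by move=> e' C c k0 _; apply: hits_geo_closed.
apply: (nested_selfsimilar (j := j%:Z) (prime_gt1 p_prime) e0 Ucl XN).
move=> n; rewrite {1}(slicesE e (hits U) n); split=> [[m mI [n' Un' ->]]|].
  have [mj|mj] := eqVneq m j; last by left; exists m; [rewrite mem_filter mj|exists n'].
  right; exists n'; last by rewrite mj.
  by apply: (hits_frob n' (frob_rel_eqmx UU)).1; rewrite -mj.
case=> [[m]|[n' Un' ->]]; first by rewrite mem_filter => /andP[_ mI] mP; exists m.
exists j; first by rewrite mem_iota.
by exists n' => //; apply: (hits_frob n' (frob_rel_eqmx UU)).2.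
Qed.

Lemma nf_nested (A : 'M[L]_(r, t)) i b :
  colsub f A = 1%:M -> b != f i -> A i b != 0 -> nested p r (hits A).
Proof.
move=> nfA bfi Aib.
have [eA|nA] := classic (exhausted A).
  exact: nestedW (leq_pred r) (exhausted_nested nfA eA).
have [k [m [U [e [j [ltm AU e0 ltj UU]]]]]] := periodic_descendant nA.
have nU := periodic_not_exhausted e0 UU.
have Uib : U i b != 0.
  apply: contraNneq Aib => Uib; rewrite AU Uib expr0n.
  by rewrite (negPf (lt0n_neq0 (pX_gt0 k))) mulr0.
have UN := periodic_nested (frob_rel_nf AU nfA) bfi Uib e0 ltj UU.
apply: nested_ext (fun n => iff_sym (slicesE k (hits A) n)) _.
apply: nested_slices => m'; rewrite mem_iota add0n => ltm'.
have [->|mm'] := eqVneq m' m.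
  by apply: nested_ext UN => n; apply: iff_sym; apply: hits_frob; apply: frob_rel_eqmx.
apply: nestedW (leq_pred r) _.
exact: (slice_nested nfA bfi Aib ltm ltm' mm' AU nU).
Qed.

End Induction.
End NormalForm.

(** [r < t] leaves a column that is not a pivot. It is not zero as soon as [W] contains a power
    vector, whose coordinates are all nonzero; this supplies the entry [A i b] for [nf_nested]. *)
Lemma subspace_nested r (W : 'M[L]_t) :
  (\rank W <= r)%N -> (r < t)%N -> nested p r (hits W).
Proof.
elim: r W => [|r IH] W rW ltrt.
  apply: nested_empty => n nW; have := leq_trans (mxrankS nW) rW.
  rewrite leqn0 mxrank_eq0 => /eqP/rowP/(_ (Ordinal ltrt))/eqP.
  by rewrite !mxE expfz_eq0 (negPf (beta0 _)) andbF.
have IHr (U : 'M[L]_t) : (\rank U < r.+1)%N -> nested p r (hits U).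
  by rewrite ltnS => rU; apply: IH => //; apply: ltnW.
have [/IHr/(nestedW (leqnSn r))//|geW] := ltnP (\rank W) r.+1.
have {rW geW} rW : \rank W = r.+1 by apply/eqP; rewrite eqn_leq rW.
have [[n0 n0W]|nW] := classic (exists n, hits W n); last first.
  by apply: nested_empty => n Wn; apply: nW; exists n.
have [B [Bfree BW]] : exists B : 'M[L]_(r.+1, t), row_free B /\ (B :=: W)%MS.
  rewrite -rW; exists (row_base W); split; first exact: row_base_free.
  exact: eq_row_base.
have BTfull : row_full B^T by rewrite /row_full mxrank_tr.
pose f := fullrankfun BTfull.
have [|A [nfA AB]] := @nf_of_unit _ f B.
  by rewrite -unitmx_tr trmx_mxsub; apply: fullrowsub_unit.
have AW : (A :=: W)%MS := eqmx_trans AB BW.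
have WA n : hits A n <-> hits W n by rewrite /hits AW.
have [b bf] : exists b, b \notin codom f.
  apply/existsP; rewrite -negb_forall; apply/negP => /forallP full.
  have : (#|'I_t| <= #|codom f|)%N by apply/subset_leq_card/subsetP => b _; apply: full.
  rewrite card_ord leqNgt; move/negP; apply; apply: leq_ltn_trans ltrt.
  by rewrite (leq_trans (leq_image_card _ _)) // card_ord.
have [i Aib] : exists i, A i b != 0.
  have /WA/submxP[Q QE] := n0W; apply/existsP; rewrite -negb_forall.
  apply/negP => /forallP A0; have := congr1 (fun M : 'rV_t => M 0 b) QE.
  rewrite !mxE big1 => [/eqP|i _]; first by rewrite expfz_eq0 (negPf (beta0 b)) andbF.
  by move/eqP: (A0 i) => ->; rewrite mulr0.
apply: nested_ext WA _.
apply: (nf_nested IHr nfA _ Aib).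
by apply: contraNneq bf => ->; apply: codom_f.
Qed.
End Descent.

(** * Power sums and recurrences *)

(** The sum vanishes exactly when the power vector lies in the kernel of the coefficient column, a
    hyperplane, once everything is moved to a subfield with the finiteness property. *)
Lemma power_sum_nested (K : fieldType) (p t : nat) (c delta : 'I_t.+1 -> K) :
  p \in [pchar K] -> (forall i, c i != 0) -> (forall i, delta i != 0) ->
  (forall i j n, i != j -> (0 < n)%N -> delta i ^+ n != delta j ^+ n) ->
  nested p t (fun n : int => \sum_i c i * delta i ^ n = 0).
Proof.
move=> hp c0 d0 dnt.
have [L [iota [hpL L_fin sL]]] := height_finite_cover (codom c ++ codom delta) hp.
have [c' c'E] : exists c' : 'I_t.+1 -> L, forall i, iota (c' i) = c i.
  apply: (fin_all_exists (P := fun i x => iota x = c i)) => i.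
  by apply: sL; rewrite mem_cat codom_f.
have [d' d'E] : exists d' : 'I_t.+1 -> L, forall i, iota (d' i) = delta i.
  apply: (fin_all_exists (P := fun i x => iota x = delta i)) => i.
  by apply: sL; rewrite mem_cat codom_f orbT.
have d'0 i : d' i != 0 by rewrite -(fmorph_eq0 iota) d'E.
have d'nt i j n : i != j -> (0 < n)%N -> d' i ^+ n != d' j ^+ n.
  by move=> ij n0; rewrite -(inj_eq (fmorph_inj iota)) !rmorphXn !d'E dnt.
pose C := \col_i c' i; have rk : (\rank (kermx C) <= t)%N.
  have rC : (0 < \rank C)%N.
    rewrite lt0n mxrank_eq0; apply/eqP => C0; have := congr1 (fun M : 'cV_t.+1 => M 0 0) C0.
    by move/eqP; rewrite !mxE -(fmorph_eq0 iota) c'E (negPf (c0 0)).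
  by rewrite mxrank_ker leq_subLR; apply: (@leq_add 1 t (\rank C) t).
apply: nested_ext (subspace_nested hpL L_fin d'0 d'nt rk (ltnSn t)) => n.
rewrite /hits; have -> : (pow_row d' n <= kermx C)%MS = (\sum_i c' i * d' i ^ n == 0).
  have E : pow_row d' n *m C = (\sum_i c' i * d' i ^ n)%:M.
    apply/matrixP => i j; rewrite !ord1 [LHS]mxE [RHS]mxE eqxx mulr1n.
    by apply: eq_bigr => k _; rewrite !mxE mulrC.
  rewrite sub_kermx E; apply/eqP/eqP => [/matrixP/(_ 0 0)|->].
    by rewrite !mxE eqxx mulr1n.
  by apply/matrixP => i j; rewrite !mxE mul0rn.
rewrite -(fmorph_eq0 iota) rmorph_sum /=.
rewrite (eq_bigr (fun i => c i * delta i ^ n)) => [|i _]; last first.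
  by rewrite rmorphM /= fmorphXz c'E d'E.
by split=> [/eqP|/eqP].
Qed.

Lemma irreducible_factor (F : fieldType) (f : {poly F}) : (1 < size f)%N ->
  exists g, irreducible_poly g /\ g %| f.
Proof.
move=> sf; have [n [[g [sg gf gn]] gmin]] : exists n,
    (exists g : {poly F}, [/\ (1 < size g)%N, g %| f & size g = n]) /\
    forall m, (exists g : {poly F}, [/\ (1 < size g)%N, g %| f & size g = m]) -> (n <= m)%N.
  by apply: exists_minn; exists (size f), f.
exists g; split=> //; split=> // h sh hg.
have h0 : h != 0 by apply: contraTneq hg => ->; rewrite dvd0p -size_poly_eq0 -lt0n ltnW.
have sh1 : (1 < size h)%N by rewrite ltn_neqAle eq_sym sh size_poly_gt0.
have g0 : g != 0 by rewrite -size_poly_gt0 ltnW.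
have nh : (n <= size h)%N by apply: gmin; exists h; split=> //; apply: dvdp_trans gf.
by rewrite -dvdp_size_eqp // eqn_leq dvdp_leq //= gn.
Qed.

Lemma monic_split (K : fieldType) (f : {poly K}) : f \is monic ->
  exists (F : fieldType) (iota : {rmorphism K -> F}) (rs : seq F),
    map_poly iota f = \prod_(x <- rs) ('X - x%:P).
Proof.
have [n] := ubnP (size f); elim: n K f => // n IH K f sf fm.
have [sf1|sf1] := leqP (size f) 1.
  exists K, idfun, [::]; rewrite big_nil map_poly_id //.
  by move/size1_polyC: sf1 fm => ->; rewrite monicE lead_coefC => /eqP->.
have [g [g_irr gf]] := irreducible_factor sf1.
have [L _ [z gz _]] := irredp_FAdjoin g_irr.
pose i1 : {rmorphism K -> L} := in_alg L.
have /factor_theorem[h hE] : root (map_poly i1 f) z.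
  by case/dvdpP: gf => q ->; rewrite rmorphM rootM gz orbT.
have hm : h \is monic by rewrite -(monicMr _ (monicXsubC z)) -hE map_monic.
have sh : (size h < n)%N.
  rewrite -ltnS; apply: leq_trans sf; rewrite ltnS -(size_map_poly i1) hE.
  by rewrite size_Mmonic ?monicXsubC ?monic_neq0 // size_XsubC addn2.
have [F [i2 [rs rsE]]] := IH L h sh hm.
exists F, (i2 \o i1 : {rmorphism K -> F}), (i2 z :: rs).
rewrite big_cons -rsE map_poly_comp hE rmorphM /= rmorphB /= map_polyX map_polyC.
by rewrite mulrC.
Qed.

(** * Polynomials in the shift operator *)

Section ShiftAction.
Variable F : fieldType.
Implicit Types (f g : {poly F}) (a : nat -> F).

Definition shift_act f a n := \sum_(i < size f) f`_i * a (n + i)%N.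

Lemma shift_actE N f a n : (size f <= N)%N ->
  shift_act f a n = \sum_(i < N) f`_i * a (n + i)%N.
Proof.
move=> le; rewrite /shift_act (big_ord_widen N (fun i => f`_i * a (n + i)%N)) //.
rewrite big_mkcond; apply: eq_bigr => i _; case: ltnP => // ge.
by rewrite nth_default // mul0r.
Qed.

Lemma shift_actD f g a n : shift_act (f + g) a n = shift_act f a n + shift_act g a n.
Proof.
rewrite !(@shift_actE (maxn (size f) (size g))) ?leq_maxl ?leq_maxr ?size_polyD //.
by rewrite -big_split; apply: eq_bigr => i _; rewrite coefD mulrDl.
Qed.

Lemma shift_actZ (c : F) f a n : shift_act (c *: f) a n = c * shift_act f a n.
Proof.
rewrite (@shift_actE (size f)) ?size_scale_leq // mulr_sumr.
by apply: eq_bigr => i _; rewrite coefZ mulrA.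
Qed.

Lemma shift_actMX f a n : shift_act (f * 'X) a n = shift_act f a n.+1.
Proof.
rewrite (@shift_actE (size f).+1); last first.
  by apply: leq_trans (size_polyMleq _ _) _; rewrite size_polyX addn2.
rewrite big_ord_recl coefMX mul0r add0r; apply: eq_bigr => i _.
by rewrite coefMX /= /bump /= add1n addSnnS.
Qed.

Lemma shift_actC (c : F) a n : shift_act c%:P a n = c * a n.
Proof.
rewrite (@shift_actE 1) ?size_polyC_leq1 // big_ord1 coefC addn0 //.
Qed.

Lemma shift_actM f g a n : shift_act (f * g) a n = shift_act f (shift_act g a) n.
Proof.
elim/poly_ind: f n => [|f c IH] n.
  by rewrite mul0r -[0]polyC0 !shift_actC !mul0r.
rewrite mulrDl shift_actD mul_polyC shift_actZ -mulrA ['X * g]mulrC mulrA.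
by rewrite shift_actMX IH shift_actD shift_actMX shift_actC.
Qed.

Lemma shift_act_eq f a a' : (forall n, a n = a' n) ->
  forall n, shift_act f a n = shift_act f a' n.
Proof. by move=> aa' n; apply: eq_bigr => i _; rewrite aa'. Qed.

Lemma shift_act0 f a n : (forall n, a n = 0) -> shift_act f a n = 0.
Proof. by move=> a0; apply: big1 => i _; rewrite a0 mulr0. Qed.

Lemma shift_actXnsubC P (y : F) a n :
  shift_act ('X^P - y%:P) a n = a (n + P)%N - y * a n.
Proof.
rewrite shift_actD -polyCN shift_actC mulNr; congr (_ - _).
elim: P n => [|P IH] n; first by rewrite expr0 -[1]polyC1 shift_actC mul1r addn0.
by rewrite exprSr shift_actMX IH addSnnS.
Qed.

(** Removing the factor of [y] leaves a power sum over the other roots by induction. The shift by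
    [P] minus [y] multiplies the term of [z] by [z - y], so dividing by [z - y] gives a particular
    solution; what remains is geometric of ratio [y]. *)
Lemma separable_power_sum (P : nat) (ys : seq F) a :
  uniq ys ->
  (forall n, shift_act (\prod_(y <- ys) ('X^P - y%:P)) a n = 0) ->
  exists c : nat -> F -> F, forall m n,
    a (m + P * n)%N = \sum_(y <- ys) c m y * y ^+ n.
Proof.
elim: ys a => [|y ys IH] a /=.
  move=> _ a0; exists (fun _ _ => 0) => m n; rewrite big_nil.
  by have := a0 (m + P * n)%N; rewrite big_nil -[1]polyC1 shift_actC mul1r.
case/andP=> yys uys a0; pose b n := a (n + P)%N - y * a n.
have [n|c cE] := IH b uys.
  rewrite -[RHS](a0 n) big_cons mulrC shift_actM.
  by apply: shift_act_eq => k; rewrite shift_actXnsubC.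
pose e m n := a (m + P * n)%N - \sum_(z <- ys) c m z / (z - y) * z ^+ n.
have eS m n : e m n.+1 = y * e m n.
  have bE : a (m + P * n.+1)%N = y * a (m + P * n)%N + \sum_(z <- ys) c m z * z ^+ n.
    by rewrite -cE /b -addnA -mulnSr; ring.
  rewrite /e bE mulrBr mulr_sumr -addrA; congr (_ + _).
  rewrite -sumrB -sumrN; apply: eq_big_seq => z zys.
  have zy : z - y != 0.
    by rewrite subr_eq0; apply: contraNneq yys => <-.
  by rewrite exprS; field.
have eE m n : e m n = e m 0%N * y ^+ n.
  by elim: n => [|n IHn]; rewrite ?mulr1 // eS IHn exprS; ring.
exists (fun m z => if z == y then e m 0%N else c m z / (z - y)) => m n.
rewrite big_cons eqxx -eE /e; rewrite [X in _ = _ + X](_ : _ =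
  \sum_(z <- ys) c m z / (z - y) * z ^+ n) ?subrK //.
by apply: eq_big_seq => z zys; rewrite (negPf (memPn yys z zys)).
Qed.

End ShiftAction.

Lemma exprBn_pchar_pow (R : comNzRingType) (p s : nat) (x y : R) : p \in [pchar R] ->
  (x - y) ^+ (p ^ s) = x ^+ (p ^ s) - y ^+ (p ^ s).
Proof.
move=> hp; elim: s => [|s IH]; first by rewrite expn0 !expr1.
by rewrite expnSr !exprM IH -!(pFrobenius_autE hp) rmorphB.
Qed.

Lemma torsion_exponent (F : fieldType) (l : seq (F * F)) : exists2 N, (0 < N)%N &
  forall x, x \in l -> (exists2 n, (0 < n)%N & x.1 ^+ n = x.2 ^+ n) -> x.1 ^+ N = x.2 ^+ N.
Proof.
elim: l => [|y l [N N0 IH]]; first by exists 1%N.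
have [[n n0 yn]|ny] := classic (exists2 n, (0 < n)%N & y.1 ^+ n = y.2 ^+ n).
  exists (n * N)%N => [|x]; first by rewrite muln_gt0 n0.
  rewrite inE => /orP[/eqP-> _|/IH xP /xP xN]; first by rewrite !exprM yn.
  by rewrite mulnC !exprM xN.
by exists N => // x; rewrite inE => /orP[/eqP-> /ny|/IH].
Qed.

(** Multiplicities disappear because [('X - x) ^ P = 'X^P - x ^ P] for a power [P] of [p]: on each
    class modulo [P] the sequence is a power sum with constant coefficients. A further factor [N] of
    the modulus merges bases whose ratio is a root of unity. *)
Lemma power_sum_slices (K : fieldType) (p : nat) (a : nat -> K) (d : nat) :
  p \in [pchar K] -> satisfies_rec a d ->
  exists (F : fieldType) (iota : {rmorphism K -> F}) (M n0 : nat),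
    [/\ p \in [pchar F], (0 < M)%N &
    forall m, exists (t : nat) (c delta : 'I_t -> F),
      [/\ (t <= d)%N, forall i, c i != 0, forall i, delta i != 0,
       forall i j n, i != j -> (0 < n)%N -> delta i ^+ n != delta j ^+ n &
       forall n, iota (a (n0 + m + M * n)%N) = \sum_i c i * delta i ^+ n]].
Proof.
move=> hp [g gP]; have p_pr := pcharf_prime hp.
pose h k := oapp g 0 (insub k : option 'I_d).
pose f := 'X^d - \poly_(k < d) h k.
have fm : f \is monic.
  rewrite monicE lead_coefDl ?lead_coefXn // size_polyN size_polyXn ltnS.
  exact: size_poly.
have fa n : shift_act f a n = 0.
  rewrite /f shift_actD -scaleN1r shift_actZ mulN1r.
  have -> : 'X^d = 'X^d - 0%:P :> {poly K} by rewrite subr0.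
  rewrite shift_actXnsubC mul0r subr0 gP (@shift_actE _ d) ?size_poly //.
  apply/eqP; rewrite subr_eq0; apply/eqP; apply: eq_bigr => i _.
  by rewrite coef_poly ltn_ord /h valK.
have [F [iota [rs rsE]]] := monic_split fm.
have hpF : p \in [pchar F] := rmorph_pchar iota hp.
have rsd : size rs = d.
  have := size_map_poly iota f; rewrite rsE size_prod_XsubC => rsf.
  apply: succn_inj; rewrite rsf size_polyDl ?size_polyXn // size_polyN ltnS.
  exact: size_poly.
pose b n := iota (a n).
have fb n : shift_act (\prod_(x <- rs) ('X - x%:P)) b n = 0.
  rewrite -rsE -[RHS](rmorph0 iota) -(fa n) rmorph_sum /shift_act size_map_poly.
  by apply: eq_bigr => i _; rewrite coef_map rmorphM.
(* [P] exceeds every multiplicity, so the product over distinct roots of the [P]-th powers is a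
   multiple of the characteristic polynomial. *)
pose P := (p ^ size rs)%N; have ltP : (size rs < P)%N by rewrite ltn_expl ?prime_gt1.
pose us := undup rs; pose ys := [seq x ^+ P | x <- us].
have ysu : uniq ys.
  by rewrite map_inj_uniq ?undup_uniq // => x y; apply: (frob_inj hpF).
have ysE : \prod_(y <- ys) ('X^P - y%:P) = \prod_(x <- us) ('X - x%:P) ^+ P.
  rewrite big_map; apply: eq_bigr => x _.
  by rewrite exprBn_pchar_pow ?pchar_poly // polyC_exp.
have dvd : \prod_(x <- rs) ('X - x%:P) %| \prod_(y <- ys) ('X^P - y%:P).
  rewrite ysE -(big_undup_iterop_count _ rs predT) /=.
  apply: (big_ind2 (fun u v : {poly F} => u %| v)) => [|*|x _]; rewrite ?dvdpp //.
    exact: dvdp_mul.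
  by apply: dvdp_exp2l; apply: leq_trans (count_size _ _) (ltnW ltP).
have yb n : shift_act (\prod_(y <- ys) ('X^P - y%:P)) b n = 0.
  by case/dvdpP: dvd => k ->; rewrite shift_actM shift_act0.
have [c cE] := separable_power_sum ysu yb.
have [N N0 NP] := torsion_exponent [seq (y, z) | y <- ys, z <- ys].
exists F, iota, (P * N)%N, P; split=> //.
  by rewrite muln_gt0 N0 (leq_ltn_trans _ ltP).
move=> m; pose zs := [seq y <- ys | y != 0]; pose w y := c m y * y.
(* Bases with the same [N]-th power are grouped; [es] keeps the groups whose coefficients do not
   cancel. *)
pose C del := \sum_(y <- zs | y ^+ N == del) w y.
pose ds := undup [seq y ^+ N | y <- zs]; pose es := [seq del <- ds | C del != 0].
have es_ys del : del \in es -> exists2 y, y \in ys & y != 0 /\ del = y ^+ N.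
  rewrite mem_filter mem_undup => /andP[_ /mapP[y]].
  by rewrite mem_filter => /andP[y0 yy] ->; exists y.
have esu : uniq es by rewrite filter_uniq ?undup_uniq.
have sumE n : b (P + m + P * N * n)%N = \sum_(del <- es) C del * del ^+ n.
  (* The offset [P] makes the exponent [1 + N * n] positive, so a zero base contributes nothing. *)
  have -> : (P + m + P * N * n = m + P * (1 + N * n))%N by ring.
  rewrite cE.
  transitivity (\sum_(y <- zs) w y * (y ^+ N) ^+ n).
    rewrite big_filter [RHS]big_mkcond; apply: eq_bigr => y _; rewrite /w.
    case: eqP => [->|_]; first by rewrite add1n exprS mul0r mulr0.
    by rewrite add1n exprS exprM; ring.
  transitivity (\sum_(del <- ds) C del * del ^+ n); last first.
    rewrite big_filter [RHS]big_mkcond; apply: eq_bigr => del _.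
    by case: eqP => // ->; rewrite mul0r.
  transitivity (\sum_(del <- ds) \sum_(y <- zs | y ^+ N == del) w y * (y ^+ N) ^+ n).
    rewrite (exchange_big_dep predT) //=; apply: eq_big_seq => y yzs.
    rewrite big_mkcond (bigD1_seq (y ^+ N)) ?undup_uniq //=; last first.
      by rewrite mem_undup; apply: (map_f (fun z => z ^+ N)).
    rewrite eqxx big1 ?addr0 // => del; rewrite eq_sym.
    by case: eqP.
  apply: eq_bigr => del _; rewrite mulr_suml; apply: eq_bigr => y /eqP<- //.
exists (size es), (fun i => C es`_i), (fun i => es`_i); split.
- rewrite -rsd; apply: leq_trans (size_undup rs); rewrite -/us.
  rewrite size_filter; apply: leq_trans (count_size _ _) _.
  apply: leq_trans (size_undup _) _; rewrite size_map size_filter.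
  by apply: leq_trans (count_size _ _) _; rewrite size_map.
- by move=> i; have := mem_nth 0 (ltn_ord i); rewrite mem_filter => /andP[].
- move=> i; have [y _ [y0 ->]] := es_ys _ (mem_nth 0 (ltn_ord i)).
  exact: expf_neq0.
- move=> i j n ij n0; apply/eqP => E; move/negP: ij; apply.
  have [y yy [_ yE]] := es_ys _ (mem_nth 0 (ltn_ord i)).
  have [z zz [_ zE]] := es_ys _ (mem_nth 0 (ltn_ord j)).
  rewrite -(inj_eq val_inj) -(nth_uniq 0 _ _ esu) ?ltn_ord // yE zE; apply/eqP.
  apply: (NP (y, z)); first by apply/allpairsP; exists (y, z).
  by exists (N * n)%N; rewrite ?muln_gt0 ?N0 // !exprM /= -yE -zE.
by move=> n; rewrite [LHS]sumE (big_nth 0) big_mkord.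
Qed.

(** * Back to the naturals *)

Lemma geo_points_filter q C cs n :
  geo_points q C [seq c <- cs | c != 0] n <-> geo_points q C cs n.
Proof.
elim: cs C => [|c cs IH] C //=; case: eqP => [->|_] /=.
  split=> [/IH H|[k]]; first by exists 0%N; rewrite mul0r addr0.
  by rewrite mul0r addr0 => /IH.
by split=> -[k /IH H]; exists k.
Qed.

Lemma geo_points_sum q C (cs : seq int) n : geo_points q C cs n <->
  exists k : 'I_(size cs) -> nat, n = C + \sum_(i < size cs) cs`_i * (geo q (k i))%:Z.
Proof.
elim: cs C => [|c cs IH] C /=.
  split=> [->|[k ->]]; last by rewrite big_ord0 addr0.
  by exists (fun _ => 0%N); rewrite big_ord0 addr0.
split=> [[k0 /IH[k ->]]|[k nE]].
  exists (fun i => if unlift ord0 i is Some j then k j else k0).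
  rewrite big_ord_recl unlift_none addrA; congr (_ + _).
  by apply: eq_bigr => i _; rewrite liftK.
exists (k ord0); apply/IH; exists (fun i => k (lift ord0 i)).
by rewrite nE big_ord_recl addrA.
Qed.

(** Without a positive coefficient, a case excluded from elementary nested sets, only finitely many
    naturals occur. *)
Lemma geo_points_le q C cs n : (forall c, c \in cs -> (c <= 0)%R) ->
  geo_points q C cs n -> (n <= C)%R.
Proof.
elim: cs C => [|c cs IH] C /= cs0; first by move=> ->.
case=> k nP; apply: le_trans (IH _ _ nP) _ => [x xcs|].
  by apply: cs0; rewrite inE xcs orbT.
by rewrite gerDl mulr_le0_ge0 // cs0 ?mem_head.
Qed.

Lemma finite_exact (T : eqType) (P : T -> Prop) : finite_pred P ->
  exists s : seq T, forall x, P x <-> x \in s.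
Proof.
move=> [s sP]; suff [u uP] : exists u : seq T, forall x, x \in u <-> x \in s /\ P x.
  by exists u => x; rewrite uP; split=> [Px|[]]; first by split=> //; apply: sP.
elim: s {sP} => [|y s [u uP]]; first by exists [::] => x; split=> [|[]].
have [Py|nPy] := classic (P y).
  exists (y :: u) => x; rewrite !inE; split=> [/orP[/eqP->|/uP[xs Px]]|[/orP[->//|xs] Px]].
  - by rewrite eqxx.
  - by rewrite xs orbT.
  by apply/orP; right; apply/uP.
exists u => x; rewrite uP inE; split=> [[-> Px]|[/orP[/eqP->|xs] Px]] //.
by rewrite orbT.
Qed.

Section Pnested.
Variables (p k : nat).
Hypothesis p_gt1 : (1 < p)%N.

Lemma pnested_ext B B' : (forall n, B n <-> B' n) -> pnested p k B -> pnested p k B'.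
Proof.
by move=> BB' [F [m [E [EP BE]]]]; exists F, m, E; split=> // n; rewrite -BB'.
Qed.

Lemma pnested_finite B : finite_pred B -> pnested p k B.
Proof.
move=> /finite_exact[F FP]; exists F, 0%N, (fun _ _ => False); split=> [[]//|n].
by split=> [/FP nF|[/FP//|[j []]]]; left.
Qed.

Lemma pnested_elementary r B : (r <= k)%N -> elementary_pnested p r B -> pnested p k B.
Proof.
move=> rk Bel; exists [::], 1%N, (fun _ => B); split=> [_|n]; first by exists r.
by split=> [Bn|[//|[_]]//]; right; exists ord0.
Qed.

Lemma pnested_union B1 B2 : pnested p k B1 -> pnested p k B2 ->
  pnested p k (fun n => B1 n \/ B2 n).
Proof.
move=> [F1 [m1 [E1 [EP1 BE1]]]] [F2 [m2 [E2 [EP2 BE2]]]].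
exists (F1 ++ F2), (m1 + m2)%N, (fun j => match split j with inl i => E1 i | inr i => E2 i end).
split=> [j|n]; first by case: (split j) => i; [apply: EP1|apply: EP2].
rewrite mem_cat BE1 BE2; split.
  case=> [[->|[j jE]]|[->|[j jE]]]; [by left| |by left; rewrite orbT|]; right.
    by exists (lshift m2 j); rewrite -[lshift m2 j]/(unsplit (inl j)) unsplitK.
  by exists (rshift m1 j); rewrite -[rshift m1 j]/(unsplit (inr j)) unsplitK.
case=> [/orP[nF|nF]|[j]]; [by left; left|by right; left|].
by case: (split j) => i iE; [left|right]; right; exists i.
Qed.

Lemma geo_points_pnested e C cs : (0 < e)%N -> (size cs <= k)%N ->
  pnested p k (fun n : nat => geo_points (p ^ e) C cs n%:Z).
Proof.
move=> e0 csk; pose q := (p ^ e)%N; pose ds := [seq c <- cs | c != 0].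
apply: (@pnested_ext (fun n : nat => geo_points q C ds n%:Z)).
  by move=> n; apply: geo_points_filter.
have q_gt1 : (1 < q)%N by rewrite /q -(exp1n e) ltn_exp2r.
have [[c [cds c0]]|npos] := classic (exists c, c \in ds /\ (0 < c)%R); last first.
  apply: pnested_finite; exists (iota 0 (absz C).+1) => n /geo_points_le nC.
  rewrite mem_iota /= add0n ltnS.
  have : (n%:Z <= C)%R.
    apply: nC => c cds; rewrite leNgt; apply/negP => c0; apply: npos; by exists c.
  by clear; lia.
apply: (@pnested_elementary (size ds)).
  by apply: leq_trans csk; rewrite size_filter count_size.
split; first by case: ds cds.
(* The coefficients are divided by [q - 1], because [c * geo q k] equals
   [c / (q - 1) * q ^ k - c / (q - 1)]; the constants go into [c0']. *)
pose Q : rat := q.-1%:R; have Q0 : Q != 0 by rewrite pnatr_eq0 -lt0n -subn1 subn_gt0.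
pose c1 (i : 'I_(size ds)) : rat := (ds`_i)%:~R / Q.
pose c0' : rat := C%:~R - \sum_i c1 i.
exists e, c0', c1; split=> //; split; last split; last split; last split; last split.
- exists (q.-1%:Z * C - \sum_(i < size ds) ds`_i).
  rewrite /c0' mulrBr rmorphB rmorphM /= mulr_sumr rmorph_sum /=; congr (_ - _).
  by apply: eq_bigr => i _; rewrite /c1 mulrC divfK.
- by move=> i; exists ds`_i; rewrite /c1 mulrC divfK.
- by exists C; rewrite /c0' subrK.
- move=> i; rewrite mulf_neq0 ?invr_eq0 // intr_eq0.
  by have := mem_nth 0 (ltn_ord i); rewrite mem_filter => /andP[].
- have ltc : (index c ds < size ds)%N by rewrite index_mem.
  exists (Ordinal ltc); rewrite /c1 /= nth_index // divr_gt0 ?ltr0z //.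
  by rewrite ltr0n -subn1 subn_gt0.
have SE (l : 'I_(size ds) -> nat) : c0' + \sum_i c1 i * (q ^ l i)%N%:R =
    (C + \sum_(i < size ds) ds`_i * (geo q (l i))%:Z)%:~R :> rat.
  rewrite rmorphD rmorph_sum /= /c0' -addrA; congr (_ + _).
  rewrite -sumrN -big_split; apply: eq_bigr => i _ /=.
  rewrite -(geo_pred (l i) (ltnW q_gt1)) natrD natrM subn1 -/Q rmorphM /= /c1.
  by rewrite -[((geo q (l i))%:Z)%:~R]/((geo q (l i))%:R : rat); field.
move=> n; rewrite geo_points_sum; split=> -[l lE]; exists l.
  by rewrite SE -lE.
by apply/eqP; rewrite -(eqr_int rat) -SE lE.
Qed.

Lemma nested_pnested Z : nested p k.+1 Z -> pnested p k (fun n : nat => Z n%:Z).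
Proof.
move=> [e e0 [l [lr lP]]].
apply: (@pnested_ext (fun n : nat => exists2 x, x \in l & geo_points (p ^ e) x.1 x.2 n%:Z)).
  by move=> n; apply: iff_sym; apply: lP.
elim: l lr {lP} => [|x l IH] lr; first by apply: pnested_finite; exists [::] => n [].
apply: pnested_ext (pnested_union (geo_points_pnested x.1 e0 (lr x (mem_head _ _))) (IH _)).
  move=> n; split=> [[nx|[y yl ny]]|[y]].
  - by exists x; rewrite ?mem_head.
  - by exists y; rewrite // inE yl orbT.
  by rewrite inE => /orP[/eqP->|yl] ny; [left|right; exists y].
by move=> y yl; apply: lr; rewrite inE yl orbT.
Qed.

End Pnested.

Theorem theorem1p8 (K : fieldType) (p : nat) (hp : p \in [pchar K])
  (a : nat -> K) (d : nat) (ha : rec_order a d) :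
  pnormal p (d - 2)%N (fun n : nat => a n = 0).
Proof.
have p_gt1 := prime_gt1 (pcharf_prime hp).
have [F [phi [M [n0 [hpF M0 slices]]]]] := power_sum_slices hp ha.1.
pose zero_slice m := forall n, a (n0 + m + M * n)%N = 0.
have sliceP (m : 'I_M) : exists Z : int -> Prop, nested p (d - 2).+1 Z /\
    (zero_slice m \/ forall n : nat, a (n0 + m + M * n)%N = 0 <-> Z n%:Z).
  (* If no term survives, the slice is identically zero and becomes an arithmetic progression;
     otherwise it is a nested set. *)
  have [[|t] [c [del [td c0 del0 del_nt aE]]]] := slices m.
    exists (fun _ => False); split; first by apply: nested_empty => n [].
    by left=> n; apply: (fmorph_inj phi); rewrite aE big_ord0 rmorph0.
  exists (fun n : int => \sum_i c i * del i ^ n = 0); split.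
    by apply: nestedW (power_sum_nested hpF c0 del0 del_nt); clear -td; lia.
  right=> n; have aE' := aE n; split=> [an|sn]; first by rewrite -[RHS](rmorph0 phi) -an aE'.
  by apply: (fmorph_inj phi); rewrite aE' rmorph0.
have [Z ZP] := fin_all_exists sliceP.
have [ms msP] : exists ms : seq 'I_M, forall m : 'I_M, zero_slice m <-> m \in ms.
  apply: (finite_exact (P := fun m : 'I_M => zero_slice m)); exists (enum 'I_M) => m _.
  by rewrite mem_enum.
pose B (y : int) := exists2 m : 'I_M, m \in enum 'I_M &
  exists2 n, Z m n & y = (n0 + m)%N%:Z + M%:Z * n.
exists (fun n : nat => B n%:Z); split.
  apply: nested_pnested => //; apply: nested_bigcup => m _; apply: nested_affine.
  by have [] := ZP m.
exists (size ms), (fun i => (n0 + tnth (in_tuple ms) i, M)%N); split=> //.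
(* The slices start at [n0], and points of [B] with negative parameter lie below [n0] because
   [m < M]; the indices below [n0] form the exceptional set. *)
exists (iota 0 n0) => n; rewrite mem_iota add0n /= -leqNgt => n0n.
split=> [an|[[m _ [n' Zn' nE]]|[i [u nE]]]]; last first.
- rewrite nE /=; have /msP : tnth (in_tuple ms) i \in ms by apply: mem_tnth.
  exact.
- have [_ [zm|mE]] := ZP m; case: n' Zn' nE => n' Zn' nE.
  + have -> : n = (n0 + m + M * n')%N by clear -nE; lia.
    exact: zm.
  + by exfalso; have := ltn_ord m; clear -nE n0n; nia.
  + have -> : n = (n0 + m + M * n')%N by clear -nE; lia.
    exact/mE.
  by exfalso; have := ltn_ord m; clear -nE n0n; nia.
have ltm : ((n - n0) %% M < M)%N by rewrite ltn_mod.
pose m := Ordinal ltm; pose u := ((n - n0) %/ M)%N.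
have nE : n = (n0 + m + M * u)%N.
  by rewrite -addnA [(m + _)%N]addnC mulnC -divn_eq subnKC.
have [_ [/msP mms|mE]] := ZP m.
  right; have lti : (index m ms < size ms)%N by rewrite index_mem.
  exists (Ordinal lti), u; rewrite /= (tnth_nth m) /= nth_index //.
left; exists m; first by rewrite mem_enum.
exists u%:Z; first by apply/mE; rewrite -nE.
by rewrite -PoszM -PoszD -nE.
Qed.
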